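(* Let $\Omega$ be a compact convex regular domain of $\mathbb{R}^3$. Then $W_d(\partial\Omega)=w(\Omega)$, i.e., the min-max width of $\partial\Omega$ associated to the distance function coincides with the classical width of $\Omega$.
   Context: A regular domain is a domain with smooth boundary; here $\Sigma=\partial\Omega$ is a smoothly embedded $2$-sphere in Euclidean space $\mathbb{R}^3$, and $dist$ is the Euclidean distance. Min-max width: identify $S^2$ with $\Sigma$ via the embedding. $\mathcal{P}_\Sigma=\{\{p,q\}:p,q\in\Sigma\}$ is the set of subsets of $\Sigma$ with one or two points, with the quotient topology of $\Sigma\times\Sigma$ under $(p,q)\sim(q,p)$. Fix $x_0\in\Sigma$ and let $\Phi_0:S^2\to\mathcal{P}_\Sigma$, $\Phi_0(x)=\{x,x_0\}$. A sweepout of $\Sigma$ is a continuous map $\phi:S^2\to\mathcal{P}_\Sigma$ homotopic to $\Phi_0$ for which there exist continuous maps $\phi_1,\phi_2:S^2\to\Sigma$ with $\phi(x)=\{\phi_1(x),\phi_2(x)\}$ for all $x\in S^2$. Set $W_d(\Sigma)=\inf_\phi\max_{x\in S^2}dist(\phi_1(x),\phi_2(x))$, infimum over all sweepouts. Classical width: for a unit vector $v\in\mathbb{R}^3$, $w(\Omega,v)$ is the smallest possible distance between two planes $H_i=\{x:\langle x,v\rangle=a_i\}$, $i=1,2$, $a_1\le a_2$, such that $\langle x,v\rangle\in[a_1,a_2]$ for every $x\in\Omega$. The classical width is $w(\Omega)=\min\{w(\Omega,v):v\in\mathbb{R}^3,|v|=1\}$. *)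

(* Defs.v *)
From HB Require Import structures.
From mathcomp Require Import all_boot all_order all_algebra generic_quotient.
From mathcomp Require Import all_classical all_reals all_analysis.

Set Implicit Arguments.
Unset Strict Implicit.
Unset Printing Implicit Defensive.

Import Order.TTheory GRing.Theory Num.Theory.
Import numFieldNormedType.Exports.

Local Open Scope classical_set_scope.
Local Open Scope ring_scope.
Local Open Scope quotient_scope.

(* A subset [A : set T] used as a type is [set_type A], with the subspace
   topology. *)

Section Euclidean.
Context {R : realType}.
Local Notation R3 := 'rV[R]_3.

(* The library's norm on ['rV[R]_3] is the sup norm: it induces the usual
   topology, but not the Euclidean distance. *)
Definition dotp (x y : R3) : R := \sum_(i < 3) x 0 i * y 0 i.
Definition eucl_norm (x : R3) : R := Num.sqrt (dotp x x).
Definition eucl_dist (x y : R3) : R := eucl_norm (x - y).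

Definition eucl_set_dist (A B : set R3) : R :=
  inf [set eucl_dist p.1 p.2 | p in A `*` B].

(* Least and greatest elements; the default value [0] is taken when there is
   none. *)
Definition minimum (A : set R) : R := xget 0 (A `&` lbound A).
Definition maximum (A : set R) : R := xget 0 (A `&` ubound A).

Definition boundary (A : set R3) : set R3 := closure A `\` A°.

End Euclidean.

Definition sphere (R : realType) : set 'rV[R]_3 := [set x | eucl_norm x = 1].
Arguments sphere : clear implicits.

Section Smooth.
Context {R : realType}.
Local Notation R3 := 'rV[R]_3.

(* Partial derivatives up to order [k] exist and are continuous on [U], which
   is meant to be open. *)
Fixpoint Ck_on (k : nat) (U : set R3) (f : R3 -> R3) : Prop :=
  (forall x, U x -> {for x, continuous f}) /\
  if k is k'.+1 then
    forall i : 'I_3, (forall x, U x -> derivable f x (delta_mx 0 i)) /\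
      Ck_on k' U (fun x => 'D_(delta_mx 0 i) f x)
  else True.

(* A map between arbitrary subsets is smooth if it extends, near each point of
   its domain, to a smooth map on an open subset of the ambient space. *)
Definition smooth (A B : set R3) (f : A -> B) : Prop :=
  forall a : A, exists (U : set R3) (F : R3 -> R3),
    [/\ open U, U (val a), forall k, Ck_on k U F &
        forall x : A, U (val x) -> val (f x) = F (val x)].

Definition diffeomorphism (A B : set R3) (f : A -> B) : Prop :=
  smooth f /\ exists g : B -> A, [/\ cancel f g, cancel g f & smooth g].

(* Near each boundary point, a diffeomorphism between open sets carries [A] to
   the closed half-space of vectors with nonnegative last coordinate. *)
Definition smooth_boundary (A : set R3) : Prop :=
  forall p, boundary A p ->
    exists (U V : set R3) (f : U -> V),
      [/\ open U, open V, U p, diffeomorphism f &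
          forall x : U, A (val x) <-> 0 <= val (f x) 0 ord_max].

Definition regular_domain (A : set R3) : Prop :=
  [/\ A !=set0, connected A & smooth_boundary A].

(* A smooth embedding of the unit sphere with image [S] is the same thing as a
   diffeomorphism onto [S]. *)
Definition sphere_embedding (S : set R3) (e : sphere R -> S) : Prop :=
  diffeomorphism e.

End Smooth.

Section UnorderedPairs.
Context {T : topologicalType}.

Definition swap_rel (a b : T * T) : bool := (a == b) || (a == (b.2, b.1)).

Lemma swap_rel_refl : reflexive swap_rel.
Proof. by move=> a; rewrite /swap_rel eqxx. Qed.

Lemma swap_rel_sym : symmetric swap_rel.
Proof.
move=> [a1 a2] [b1 b2]; rewrite /swap_rel !xpair_eqE /=.
by rewrite ![_ == b1]eq_sym ![_ == b2]eq_sym [(b2 == _) && _]andbC.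
Qed.

Lemma swap_rel_trans : transitive swap_rel.
Proof.
move=> [b1 b2] [a1 a2] [c1 c2] /orP[|] /eqP[-> ->] /orP[|] /eqP[-> ->];
by rewrite /swap_rel !eqxx ?orbT.
Qed.

Definition swap_equiv := EquivRel _ swap_rel_refl swap_rel_sym swap_rel_trans.

Definition upairs : Type := quotient_topology {eq_quot swap_equiv}.

HB.instance Definition _ := Topological.on upairs.
HB.instance Definition _ := Quotient.on upairs.

Definition upair (p q : T) : upairs := \pi_upairs (p, q).

Lemma upairE (p q p' q' : T) :
  upair p q = upair p' q' <-> [set p; q] = [set p'; q'].
Proof.
have -> : upair p q = upair p' q' <-> swap_rel (p, q) (p', q').
  by split => [/eqmodP|H]; [|apply/eqmodP].
split=> [/orP[|] /eqP[-> ->]//|E]; first exact: setUC.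
have : [set p'; q'] p by rewrite -E; left.
have : [set p'; q'] q by rewrite -E; right.
have : [set p; q] p' by rewrite E; left.
have : [set p; q] q' by rewrite E; right.
rewrite /swap_rel !xpair_eqE /=.
by do 4! [case=> ?]; subst; rewrite ?eqxx ?orbT.
Qed.

End UnorderedPairs.
Arguments upairs : clear implicits.

Definition homotopic (R : realType) (X Y : topologicalType) (f g : X -> Y) :=
  exists H : X * R -> Y,
    [/\ {within [set: X] `*` `[0, 1], continuous H},
        forall x, H (x, 0) = f x & forall x, H (x, 1) = g x].

Section Widths.
Context {R : realType}.
Local Notation R3 := 'rV[R]_3.

(* [sweepout e x0 phi phi1 phi2]: [phi] is a sweepout of [S], the sphere being
   identified with [S] via [e], and [phi1], [phi2] are continuous maps such
   that [phi x] is the unordered pair of [phi1 x] and [phi2 x]. *)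
Definition sweepout (S : set R3) (e : sphere R -> S) (x0 : S)
    (phi : sphere R -> upairs S) (phi1 phi2 : sphere R -> S) : Prop :=
  [/\ continuous phi, homotopic R phi (fun x => upair (e x) x0),
      continuous phi1, continuous phi2 &
      forall x, phi x = upair (phi1 x) (phi2 x)].

Definition minmax_width (S : set R3) (e : sphere R -> S) (x0 : S) : R :=
  inf [set m | exists phi phi1 phi2, sweepout e x0 phi phi1 phi2 /\
         m = maximum (range (fun x => eucl_dist (val (phi1 x)) (val (phi2 x))))].

Definition plane (v : R3) (a : R) : set R3 := [set x | dotp x v = a].

Definition dir_width (A : set R3) (v : R3) : R :=
  minimum [set eucl_set_dist (plane v a.1) (plane v a.2) | a in
    [set a : R * R | a.1 <= a.2 /\ forall x, A x -> a.1 <= dotp x v <= a.2]].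

Definition width (A : set R3) : R :=
  minimum [set dir_width A v | v in sphere R].

End Widths.

(* Main.v *)
Require Import Defs.
From mathcomp Require Import all_boot all_order all_algebra generic_quotient.
From mathcomp Require Import all_classical all_reals all_analysis.
From mathcomp Require Import ring lra.

(** Both inequalities rest on convexity; the second one needs a topological
    obstruction.

    The min-max width is at most [width Omega]. Take a direction v of minimal
    width and an interior point o. Each point [e x] of the boundary, shrunk a
    little towards o, is pushed in direction - v until it leaves the body. The
    exit point phi2 x is continuous in x because the ray starts in the interior
    ([exit_time]), and it stays within the width of [e x] up to the shrinking
    error. Since phi2 misses the highest points of the body, it contracts in the
    boundary to a constant, so the pairs {e x, phi2 x} form a sweepout
    ([convex_body_sweepout]).

    Conversely, suppose that all pairs of a sweepout are at distance less than
    the width. A translate of the body by a vector shorter than the width meets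
    the body in an interior point ([common_interior]), which yields a continuous
    field of vectors pointing into the body at both members of the pair. The two
    maps of the sweepout are therefore homotopic to one map f, the radial
    projection of the opposite field ([close_pairs_homotopic]), and the sweepout
    is homotopic to {f x, f x}.

    This is impossible. Unordered pairs of points of the sphere form the complex
    projective plane, where {x, x0} describes a line whereas {f x, f x} runs in
    the diagonal, a conic, hence has even degree ([upair_cst_not_diag]). To
    detect the parity by hand, a pair is represented by a complex line in
    3-space, namely the range of an explicit Hermitian projection
    ([pair_proj]), and vectors in such lines are carried along a homotopy by
    multiplying the projections at closely spaced times
    ([idempotent_transport]). When x is written as the mirror image of x0 in the
    plane orthogonal to a unit vector A, the lines over the pairs {x, x0} have a
    section which is odd in A ([mirror_fix]). Carried to the pairs {f x, f x},
    it gives a continuous odd field of unit vectors orthogonal to an even one,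
    that is, a family of frames. Lifting these frames to quaternions, by the
    same transport, and applying the intermediate value theorem on half of the
    equator leads to a contradiction ([no_odd_frame]). *)

Set Implicit Arguments.
Unset Strict Implicit.
Unset Printing Implicit Defensive.

Import Order.TTheory GRing.Theory Num.Theory.
Import numFieldNormedType.Exports.

Local Open Scope classical_set_scope.
Local Open Scope ring_scope.

(** * Continuous maps and transport along idempotents *)

Lemma continuous_pair (X Y Z : topologicalType) (f : X -> Y) (g : X -> Z) :
  continuous f -> continuous g -> continuous (fun x => (f x, g x)).
Proof. by move=> cf cg x; exact: (cvg_pair (cf x) (cg x)). Qed.

Lemma continuousT_comp (X Y Z : topologicalType) (f : X -> Y) (g : Y -> Z) :
  continuous f -> continuous g -> continuous (fun x => g (f x)).
Proof. by move=> cf cg x; exact: (continuous_comp (cf x) (cg (f x))). Qed.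

Section ContinuousFunctions.
Context {R : realType} {X : topologicalType} {V : normedModType R}.
Implicit Types (f g : X -> V) (a b : X -> R).

Lemma cst_cont (Y : topologicalType) (y : Y) : continuous (fun _ : X => y).
Proof. by move=> x; exact: cvg_cst. Qed.

Lemma id_cont : continuous (fun x : X => x).
Proof. by move=> x; exact: cvg_id. Qed.

Lemma addv_cont f g :
  continuous f -> continuous g -> continuous (fun x => f x + g x).
Proof. by move=> cf cg x; apply: cvgD; [exact: cf|exact: cg]. Qed.

Lemma oppv_cont f : continuous f -> continuous (fun x => - f x).
Proof. by move=> cf x; apply: cvgN; exact: cf. Qed.

Lemma scale_cont a f :
  continuous a -> continuous f -> continuous (fun x => a x *: f x).
Proof. by move=> ca cf x; apply: cvgZ; [exact: ca|exact: cf]. Qed.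

Lemma mul_cont a b :
  continuous a -> continuous b -> continuous (fun x => a x * b x).
Proof. by move=> ca cb x; apply: cvgM; [exact: ca|exact: cb]. Qed.

Lemma max_cont a b :
  continuous a -> continuous b -> continuous (fun x => Num.max (a x) (b x)).
Proof. by move=> ca cb x; apply: (@continuous_max R X a b x (ca x) (cb x)). Qed.

Lemma min_cont a b :
  continuous a -> continuous b -> continuous (fun x => Num.min (a x) (b x)).
Proof. by move=> ca cb x; apply: (@continuous_min R X a b x (ca x) (cb x)). Qed.

Lemma sqrt_cont a : continuous a -> continuous (fun x => Num.sqrt (a x)).
Proof. by move=> ca; exact: continuousT_comp ca (@sqrt_continuous R). Qed.

Lemma inv_cont a : continuous a -> (forall x, a x != 0) ->
  continuous (fun x => (a x)^-1).
Proof. by move=> ca a0 x; apply: cvgV; [exact: a0|exact: ca]. Qed.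

End ContinuousFunctions.

Lemma continuous_dominated (R : realType) (X : topologicalType) (f : X -> R)
    (D : X -> X -> R) :
  (forall x, continuous (D x)) -> (forall x, D x x = 0) ->
  (forall x y, `|f x - f y| <= D x y) -> continuous f.
Proof.
move=> cD D0 fD x; apply/cvgrPdist_lt => e e0; near=> y.
rewrite (le_lt_trans (fD x y))//.
by near: y; apply: (cvgr_lt (D x x)); [exact: cD|rewrite D0].
Unshelve. all: by end_near. Qed.

Section ContinuousProjections.
Context {X Y : topologicalType}.

Lemma fst_cont : continuous (fun z : X * Y => z.1).
Proof. by move=> z; exact: cvg_fst. Qed.

Lemma snd_cont : continuous (fun z : X * Y => z.2).
Proof. by move=> z; exact: cvg_snd. Qed.

End ContinuousProjections.

Lemma mx_continuousP (R : realType) (X : topologicalType) m n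
    (K : X -> 'M[R]_(m, n)) :
  continuous K <-> forall i j, continuous (fun x => K x i j).
Proof.
split=> [cK i j x|cK x A /= [P KP PA]].
  exact: (continuousT_comp cK (@coord_continuous _ _ _ i j)).
rewrite nbhs_simpl /=.
apply: (@filterS _ (nbhs x) _ (fun y => forall i j, P i j (K y i j))).
  by move=> y Py; exact: PA.
by apply: filter_forall => i; apply: filter_forall => j; exact: (cK i j x).
Qed.

Lemma sum_continuous (R : realType) (X : topologicalType)
    (V : normedModType R) (I : Type) (r : seq I) (P : pred I)
    (F : I -> X -> V) :
  (forall i, P i -> continuous (F i)) ->
  continuous (fun x => \sum_(i <- r | P i) F i x).
Proof. by apply: continuous_big => //; exact: add_continuous. Qed.

Lemma mulmx_continuous (R : realType) (X : topologicalType) m n p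
    (K : X -> 'M[R]_(m, n)) (L : X -> 'M[R]_(n, p)) :
  continuous K -> continuous L -> continuous (fun x => K x *m L x).
Proof.
move=> /mx_continuousP cK /mx_continuousP cL.
apply/mx_continuousP => i j.
have -> : (fun x => (K x *m L x) i j) = fun x => \sum_k (K x i k * L x k j).
  by apply/funext => x; rewrite mxE.
apply: sum_continuous => k _ x.
by apply: cvgM; [exact: cK|exact: cL].
Qed.

Lemma mx_norm_mulmx (R : realType) n (w : 'rV[R]_n) (D : 'M[R]_n) :
  `|w *m D| <= n%:R * `|w| * `|D|.
Proof.
rewrite -[leLHS]/(mx_norm _) mx_normrE; apply/bigmax_leP; split=> [|[i j] _].
  by rewrite !mulr_ge0.
rewrite /= mxE (le_trans (ler_norm_sum _ _ _))//.
have -> : n%:R * `|w| * `|D| = \sum_(k < n) (`|w| * `|D|).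
  by rewrite sumr_const card_ord -[RHS]mulr_natl mulrA.
apply: ler_sum => k _; rewrite normrM.
have H p q (M : 'M[R]_(p, q)) a b : `|M a b| <= `|M|.
  rewrite -[leRHS]/(mx_norm _) mx_normrE.
  by apply: (le_bigmax_cond _ (fun ij => `|M ij.1 ij.2|) (j := (a, b))).
by apply: ler_pM.
Qed.

(** Heine's theorem in the parameter [t], uniformly in [x]: [X] carries no
    uniform structure, so the compactness of [X] times the unit interval enters
    through near coverings. *)
Lemma unif_continuous_param (R : realType) (X : topologicalType)
    (V : normedModType R) (K : X * R -> V) :
  compact [set: X] -> continuous K -> forall e, 0 < e ->
  exists N : nat, forall x t t', 0 <= t <= 1 ->
    `|t - t'| <= N.+1%:R^-1 -> `|K (x, t) - K (x, t')| < e.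
Proof.
move=> cX cK e e0.
have cZ : compact ([set: X] `*` `[0, 1]%classic : set (X * R)).
  by apply: compact_setX => //; exact: segment_compact.
move/compact_near_coveringP: cZ => /(_ nat \oo
  (fun N z => forall t', `|z.2 - t'| <= N.+1%:R^-1 ->
     `|K z - K (z.1, t')| < e) _).
have H : forall z, ([set: X] `*` `[0, 1]%classic : set (X * R)) z ->
  \forall z' \near z & N \near \oo, forall t', `|z'.2 - t'| <= N.+1%:R^-1 ->
     `|K z' - K (z'.1, t')| < e.
  move=> [x t] _.
  have e2 : 0 < e / 2 by rewrite divr_gt0.
  have /cvgrPdist_lt /(_ _ e2) [[U V'] /= [Ux /nbhs_ballP[d /= d0 Vd]] UV] :=
    cK (x, t).
  have d2 : 0 < d / 2 by rewrite divr_gt0.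
  have NN : \forall N \near \oo, (N.+1%:R^-1 : R) < d / 2.
    exact: near_infty_natSinv_lt (PosNum d2).
  exists (U `*` ball t (d / 2), [set N | (N.+1%:R^-1 : R) < d / 2]) => /=.
    by split => //; exists (U, ball t (d / 2)) => //=; split => //;
      exact: nbhsx_ballx.
  move=> [[x' t1] N] /= [[Ux' tt1] dN] t' t1t'.
  have K1 : `|K (x, t) - K (x', t1)| < e / 2.
    apply: (UV (x', t1)); split => //=; apply: Vd.
    by apply: (le_ball _ tt1); rewrite ler_pdivrMr// ler_peMr ?ler1n// ltW.
  have K2 : `|K (x, t) - K (x', t')| < e / 2.
    apply: (UV (x', t')); split => //=; apply: Vd.
    rewrite -ball_normE /= in tt1 *; rewrite -(subrKA t1).
    rewrite (le_lt_trans (ler_normD _ _))// [ltRHS]splitr.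
    by rewrite ltrD// (le_lt_trans t1t').
  rewrite -(subrKA (K (x, t))) (le_lt_trans (ler_normD _ _))// [ltRHS]splitr.
  by rewrite ltrD// distrC.
move=> /(_ H) [N _ /(_ N (leqnn N)) HN].
exists N => x t t' t01 tt'.
apply: (HN (x, t)) => //=.
Qed.

(** The operator [T x] is a product of values [K (x, t)] at closely spaced
    times. A vector fixed by [K (x, t)] is moved by less than its norm when the
    next factor is applied, so it is not annihilated, and idempotency puts the
    result in the range of that factor. This is the elementary side of the fact
    that homotopic families of projections are conjugate; the same [T x] serves
    all vectors over [x], which is what lets symmetries of sections survive. *)
Lemma idempotent_transport (R : realType) (X : topologicalType) n
    (K : X * R -> 'M[R]_n) :
  compact [set: X] -> continuous K -> (forall z, K z *m K z = K z) ->
  exists T : X -> 'M[R]_n, continuous T /\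
    forall x (w : 'rV_n), w != 0 -> w *m K (x, 0) = w ->
      w *m T x != 0 /\ w *m T x *m K (x, 1) = w *m T x.
Proof.
move=> cX cK idK.
(* a matrix of norm at most 1 / (n + 1) shrinks row vectors, since
   multiplication costs a factor n in the sup norm *)
have e0 : 0 < (n.+1%:R^-1 : R) by rewrite invr_gt0.
have [N HN] := unif_continuous_param cX cK e0.
pose s (k : nat) : R := k%:R / N.+1%:R.
pose T := fix T k x := if k is k'.+1 then T k' x *m K (x, s k) else 1%:M.
have cT k : continuous (T k).
  elim: k => [|k IH] /=; first exact: cst_continuous.
  apply: mulmx_continuous => //; apply: (continuousT_comp _ cK).
  by apply: continuous_pair; [exact: id_cont|exact: cst_cont].
exists (T N.+1); split => // x w w0 wK.
have s01 k : (k <= N.+1)%N -> 0 <= s k <= 1.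
  by move=> kN; rewrite divr_ge0//= ler_pdivrMr// mul1r ler_nat.
have -> : (1 : R) = s N.+1 by rewrite /s divff.
suff H k : (k <= N.+1)%N ->
    w *m T k x != 0 /\ w *m T k x *m K (x, s k) = w *m T k x by exact: H.
elim: k => [|k IH kN].
  by rewrite /= mulmx1 /s mul0r.
have [v0 vK] := IH (ltnW kN).
rewrite /= !mulmxA; set v := w *m T k x in v0 vK *.
split; last by rewrite -mulmxA idK.
apply/eqP => vK0.
have : `|v *m (K (x, s k) - K (x, s k.+1))| = `|v|.
  by rewrite mulmxBr vK vK0 subr0.
apply/eqP; rewrite lt_eqF// (le_lt_trans (mx_norm_mulmx _ _))//.
have KK : `|K (x, s k) - K (x, s k.+1)| < n.+1%:R^-1.
  apply: HN; first exact/s01/ltnW.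
  rewrite /s -mulrBl -natr1 opprD addNKr mulN1r normrN normfV ger0_norm//.
have v0' : 0 < `|v| by rewrite normr_gt0.
rewrite mulrAC gtr_pMl//.
rewrite (@le_lt_trans _ _ (n%:R / n.+1%:R))//; first by rewrite ler_wpM2l// ltW.
by rewrite ltr_pdivrMr// mul1r ltr_nat.
Qed.

(** * Subspaces and homotopies *)

Lemma val_continuous (T : topologicalType) (A : set T) :
  continuous (fun x : A => val x).
Proof. exact: initial_continuous. Qed.

Section SubsetTypes.
Context {X T : topologicalType} (A : set T).

Definition into (f : X -> T) (fA : forall x, A (f x)) (x : X) : A :=
  exist _ (f x) (mem_set (fA x)).

Lemma continuous_val (f : X -> A) :
  continuous f <-> continuous (fun x => val (f x)).
Proof.
split=> [cf|cf].
  exact: continuousT_comp cf (@val_continuous _ A).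
apply/continuousP => _ [B oB <-]; move/continuousP: cf => /(_ _ oB).
by [].
Qed.

Lemma into_continuous (f : X -> T) (fA : forall x, A (f x)) :
  continuous f -> continuous (into fA).
Proof. by move=> cf; apply/continuous_val. Qed.

End SubsetTypes.

Lemma set_type_compact (T : topologicalType) (A : set T) :
  compact A -> compact [set: A].
Proof.
move=> cA F FF _; pose G := (fun x : A => val x) @ F.
have GA : F ((fun x : A => val x) @^-1` A).
  by apply: (filterS _ (@filterT _ F _)) => x _; exact: set_valP.
have [a [Aa ca]] := cA G _ GA.
exists (exist _ a (mem_set Aa)); split => //.
move=> C D FC [_ /= [[B oB <-] Ba BD]].
have GC : F ((fun x : A => val x) @^-1` ((fun x : A => val x) @` C)).
  by apply: (filterS _ FC) => x Cx; exists x.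
have [_ [[x Cx <-] Bx]] := ca _ B GC (open_nbhs_nbhs (conj oB Ba)).
by exists x; split => //; exact: BD.
Qed.

Section Clamp.
Context {R : realType}.

Definition clamp (t : R) : R := Num.max 0 (Num.min 1 t).

Lemma clamp_itv t : 0 <= clamp t <= 1.
Proof. by rewrite /clamp le_max lexx/= ge_max ler01 ge_min lexx. Qed.

Lemma clamp_id t : 0 <= t <= 1 -> clamp t = t.
Proof. by move=> /andP[t0 t1]; rewrite /clamp min_r// max_r. Qed.

Lemma clamp_continuous : continuous clamp.
Proof.
by apply/max_cont/min_cont; [exact: cst_cont..|exact: id_cont].
Qed.

(** Composing with [clamp] extends a homotopy to all real times, so that
    continuity relative to the unit interval becomes plain continuity. *)
Lemma homotopicP (X Y : topologicalType) (f g : X -> Y) :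
  homotopic R f g <-> exists H : X * R -> Y,
    [/\ continuous H, forall x, H (x, 0) = f x & forall x, H (x, 1) = g x].
Proof.
split=> [[H [cH H0 H1]]|[H [cH H0 H1]]]; last first.
  by exists H; split => //; exact: continuous_subspaceT.
exists (fun z => H (z.1, clamp z.2)).
split; [|by move=> x; rewrite clamp_id ?lexx ?ler01..].
have cc : continuous (fun z : X * R => (z.1, clamp z.2)).
  apply: continuous_pair fst_cont _.
  exact: (continuousT_comp snd_cont clamp_continuous).
move=> z; move/subspace_continuousP : cH => /(_ (z.1, clamp z.2)).
have Az y : ([set: X] `*` `[0, 1]%classic : set (X * R)) (y.1, clamp y.2).
  by split => //=; rewrite in_itv /= clamp_itv.
move=> /(_ (Az z)) cH B /cH; rewrite /= !nbhs_simpl /= => /cc.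
by rewrite /= nbhs_simpl /=; apply: filterS => y /=; apply; exact: Az.
Qed.

Lemma homotopic_sym (X Y : topologicalType) (f g : X -> Y) :
  homotopic R f g -> homotopic R g f.
Proof.
move=> /homotopicP [H [cH H0 H1]]; apply/homotopicP.
exists (fun z => H (z.1, 1 - z.2)); split=> [|x|x] /=; last 2 first.
  by rewrite subr0. by rewrite subrr.
apply: (continuousT_comp _ cH); apply: continuous_pair fst_cont _.
by apply: addv_cont; [exact: cst_cont|exact/oppv_cont/snd_cont].
Qed.

Lemma homotopic_transport (X Y : topologicalType) n (E : Y -> 'M[R]_n)
    (f g : X -> Y) :
  compact [set: X] -> continuous E -> (forall y, E y *m E y = E y) ->
  homotopic R f g ->
  exists T : X -> 'M[R]_n, continuous T /\
    forall x (w : 'rV_n), w != 0 -> w *m E (f x) = w ->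
      w *m T x != 0 /\ w *m T x *m E (g x) = w *m T x.
Proof.
move=> cX cE idE /homotopicP [H [cH H0 H1]].
have [|z|T [cT HT]] := @idempotent_transport R X n (E \o H) cX.
- exact: continuousT_comp cH cE.
- exact: idE.
by exists T; split => // x w w0; rewrite -H0 -H1; exact: HT.
Qed.

End Clamp.

(** * Coordinates and the unit sphere *)

Notation "''i3' k" := (@Ordinal 3 k isT) (at level 0, k at level 0).
Notation "''i4' k" := (@Ordinal 4 k isT) (at level 0, k at level 0).

Section Coordinates.
Context {R : realType}.
Local Notation R3 := 'rV[R]_3.
Implicit Types x y z : R3.

Lemma sum_ord3 (F : 'I_3 -> R) :
  \sum_(i < 3) F i = F 'i3 0 + F 'i3 1 + F 'i3 2.
Proof.
rewrite !big_ord_recr big_ord0 /= add0r.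
by congr (F _ + F _ + F _); apply/val_inj.
Qed.

Lemma sum_ord4 (F : 'I_4 -> R) :
  \sum_(i < 4) F i = F 'i4 0 + F 'i4 1 + F 'i4 2 + F 'i4 3.
Proof.
rewrite !big_ord_recr big_ord0 /= add0r.
by congr (F _ + F _ + F _ + F _); apply/val_inj.
Qed.

Lemma forall_ord3 (P : 'I_3 -> Prop) :
  P 'i3 0 -> P 'i3 1 -> P 'i3 2 -> forall i, P i.
Proof.
move=> P0 P1 P2 [[|[|[|//]]] ki].
- by rewrite (_ : Ordinal ki = 'i3 0)//; exact/val_inj.
- by rewrite (_ : Ordinal ki = 'i3 1)//; exact/val_inj.
- by rewrite (_ : Ordinal ki = 'i3 2)//; exact/val_inj.
Qed.

Lemma forall_ord4 (P : 'I_4 -> Prop) :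
  P 'i4 0 -> P 'i4 1 -> P 'i4 2 -> P 'i4 3 -> forall i, P i.
Proof.
move=> P0 P1 P2 P3 [[|[|[|[|//]]]] ki].
- by rewrite (_ : Ordinal ki = 'i4 0)//; exact/val_inj.
- by rewrite (_ : Ordinal ki = 'i4 1)//; exact/val_inj.
- by rewrite (_ : Ordinal ki = 'i4 2)//; exact/val_inj.
- by rewrite (_ : Ordinal ki = 'i4 3)//; exact/val_inj.
Qed.

Definition mx_of_rows m n (l : seq (seq R)) : 'M[R]_(m, n) :=
  \matrix_(i, j) nth 0 (nth [::] l i) j.

Definition row3 (a b c : R) : R3 := mx_of_rows 1 3 [:: [:: a; b; c]].

Lemma row3E a b c :
  (row3 a b c 0 'i3 0 = a) * (row3 a b c 0 'i3 1 = b) *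
  (row3 a b c 0 'i3 2 = c).
Proof. by rewrite !mxE. Qed.

Lemma dotpE x y : dotp x y =
  x 0 'i3 0 * y 0 'i3 0 + x 0 'i3 1 * y 0 'i3 1 + x 0 'i3 2 * y 0 'i3 2.
Proof. exact: sum_ord3. Qed.

Lemma dotpC x y : dotp x y = dotp y x.
Proof. by rewrite !dotpE; ring. Qed.

Lemma dotpDl x y z : dotp (x + y) z = dotp x z + dotp y z.
Proof. by rewrite !dotpE !mxE; ring. Qed.

Lemma dotpZl a x y : dotp (a *: x) y = a * dotp x y.
Proof. by rewrite !dotpE !mxE; ring. Qed.

Lemma dotpNl x y : dotp (- x) y = - dotp x y.
Proof. by rewrite !dotpE !mxE; ring. Qed.

Lemma dotpBl x y z : dotp (x - y) z = dotp x z - dotp y z.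
Proof. by rewrite dotpDl dotpNl. Qed.

Lemma dotpDr x y z : dotp x (y + z) = dotp x y + dotp x z.
Proof. by rewrite dotpC dotpDl !(dotpC x). Qed.

Lemma dotpZr a x y : dotp x (a *: y) = a * dotp x y.
Proof. by rewrite dotpC dotpZl (dotpC x). Qed.

Lemma dotpNr x y : dotp x (- y) = - dotp x y.
Proof. by rewrite dotpC dotpNl (dotpC x). Qed.

Lemma dotpBr x y z : dotp x (y - z) = dotp x y - dotp x z.
Proof. by rewrite dotpDr dotpNr. Qed.

Lemma dotp_subZ x y a : dotp (x - a *: y) (x - a *: y) =
  dotp x x - 2 * (a * dotp y x) + a * (a * dotp y y).
Proof. by rewrite !dotpE !mxE; ring. Qed.

Lemma dotp_ge0 x : 0 <= dotp x x.
Proof. by rewrite dotpE -!expr2 !addr_ge0// sqr_ge0. Qed.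

Lemma dotp_eq0 x : (dotp x x == 0) = (x == 0).
Proof.
apply/eqP/eqP => [|->]; last by rewrite dotpE !mxE; ring.
rewrite dotpE -!expr2 => xx0.
have [] : x 0 'i3 0 ^+ 2 = 0 /\ x 0 'i3 1 ^+ 2 = 0 /\ x 0 'i3 2 ^+ 2 = 0.
  move: (sqr_ge0 (x 0 'i3 0)) (sqr_ge0 (x 0 'i3 1)) (sqr_ge0 (x 0 'i3 2)).
  by move: xx0; lra.
move=> /eqP; rewrite sqrf_eq0 => /eqP x0 [/eqP]; rewrite sqrf_eq0 => /eqP x1.
move=> /eqP; rewrite sqrf_eq0 => /eqP x2.
by apply/rowP; apply: forall_ord3; rewrite ?x0 ?x1 ?x2 mxE.
Qed.

Lemma sphereE x : sphere R x <-> dotp x x = 1.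
Proof.
rewrite /sphere /= /eucl_norm; split=> [xx|->]; last exact: sqrtr1.
by rewrite -(sqr_sqrtr (dotp_ge0 x)) xx expr1n.
Qed.

Lemma sphere_dotp (A : sphere R) : dotp (val A) (val A) = 1.
Proof. exact/sphereE/set_valP. Qed.

Lemma row_continuousP (X : topologicalType) n (f : X -> 'rV[R]_n) :
  continuous f <-> forall j, continuous (fun s => f s 0 j).
Proof.
split=> [/mx_continuousP cf j|cf]; first exact: cf.
by apply/mx_continuousP => i j; rewrite ord1; exact: cf.
Qed.

Lemma dotp_continuous (X : topologicalType) (f g : X -> R3) :
  continuous f -> continuous g -> continuous (fun s => dotp (f s) (g s)).
Proof.
move=> /row_continuousP cf /row_continuousP cg.
by apply: sum_continuous => i _ s; apply: cvgM; [exact: cf|exact: cg].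
Qed.

Lemma row3_continuous (X : topologicalType) (f g h : X -> R) :
  continuous f -> continuous g -> continuous h ->
  continuous (fun s => row3 (f s) (g s) (h s)).
Proof.
move=> cf cg ch; apply/row_continuousP; apply: forall_ord3.
- by rewrite (_ : (fun s => _) = f)//; apply/funext => s; rewrite row3E.
- by rewrite (_ : (fun s => _) = g)//; apply/funext => s; rewrite row3E.
- by rewrite (_ : (fun s => _) = h)//; apply/funext => s; rewrite row3E.
Qed.

Lemma sphere_compact : compact (sphere R).
Proof.
apply: bounded_closed_compact.
  exists 1; split => //.
  move=> M M1 x /sphereE xx; apply: le_trans (ltW M1).
  rewrite -[leLHS]/(mx_norm _) mx_normrE.
  apply/bigmax_leP; split=> [//|[i j] _].
  rewrite /= ord1 -[leRHS]sqrtr1 -sqrtr_sqr ler_sqrt//.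
  rewrite -xx dotpE; move: j.
  by apply: forall_ord3; rewrite -!expr2;
   move: (sqr_ge0 (x 0 'i3 0)) (sqr_ge0 (x 0 'i3 1)) (sqr_ge0 (x 0 'i3 2)); lra.
rewrite (_ : sphere R = (fun x => dotp x x) @^-1` [set 1]).
  apply: preimage_closed; last exact: closed_eq.
  move=> x _; apply: dotp_continuous => y; exact: cvg_id.
by apply/seteqP; split => x /sphereE.
Qed.

Lemma sphere_compactT : compact [set: sphere R].
Proof. exact/set_type_compact/sphere_compact. Qed.

Lemma antipode_sphere (A : sphere R) : sphere R (- val A).
Proof. by apply/sphereE; rewrite dotpNl dotpNr opprK sphere_dotp. Qed.

Definition antipode : sphere R -> sphere R := into antipode_sphere.

Lemma antipodeK : involutive antipode.
Proof. by move=> A; apply/val_inj; rewrite /= opprK. Qed.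

Lemma antipode_continuous : continuous antipode.
Proof.
exact/into_continuous/oppv_cont/val_continuous.
Qed.

End Coordinates.

(** * Quaternions and orthonormal frames *)

Section Quaternions.
Context {R : realType}.
Local Notation R3 := 'rV[R]_3.
Local Notation R4 := 'rV[R]_4.
Implicit Types (u p : R3) (y z : R4).

(** A row [q] of length 4 is read as the quaternion with coefficients on
    1, i, j, k, and a vector [u] as a pure quaternion. The matrix acts by
    sending [q] to -u q i, so for a unit vector [u] it fixes [q] exactly when
    q i = u q, that is, when the rotation defined by [q] takes i to [u]. *)
Definition inv_i u : 'M[R]_4 :=
  let u1 := u 0 'i3 0 in let u2 := u 0 'i3 1 in let u3 := u 0 'i3 2 in
  mx_of_rows 4 4 [:: [:: u1; 0; - u3; u2]; [:: 0; u1; u2; u3];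
                   [:: - u3; u2; - u1; 0]; [:: u2; u3; 0; - u1]].

(** The map sending the quaternion [q] to -p q k. *)
Definition inv_k p : 'M[R]_4 :=
  let p1 := p 0 'i3 0 in let p2 := p 0 'i3 1 in let p3 := p 0 'i3 2 in
  mx_of_rows 4 4 [:: [:: p3; - p2; p1; 0]; [:: - p2; - p3; 0; p1];
                   [:: p1; 0; - p3; p2]; [:: 0; p1; p2; p3]].

Lemma inv_i_sqr u : dotp u u = 1 -> inv_i u *m inv_i u = 1%:M.
Proof.
rewrite dotpE => u1; apply/matrixP.
by do 2 apply: forall_ord4; rewrite !mxE sum_ord4 !mxE /= ?mulr1n ?mulr0n;
  (ring || rewrite -u1; ring).
Qed.

Lemma inv_k_sqr p : dotp p p = 1 -> inv_k p *m inv_k p = 1%:M.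
Proof.
rewrite dotpE => p1; apply/matrixP.
by do 2 apply: forall_ord4; rewrite !mxE sum_ord4 !mxE /= ?mulr1n ?mulr0n;
  (ring || rewrite -p1; ring).
Qed.

Lemma inv_ikC u p : dotp u p = 0 -> inv_i u *m inv_k p = inv_k p *m inv_i u.
Proof.
rewrite dotpE => up; apply/matrixP.
by do 2 apply: forall_ord4; rewrite !mxE !sum_ord4 !mxE /=; move: up; lra.
Qed.

Lemma inv_i_continuous (X : topologicalType) (f : X -> R3) :
  continuous f -> continuous (fun s => inv_i (f s)).
Proof.
move=> /row_continuousP cf; apply/mx_continuousP; do 2 apply: forall_ord4;
  under eq_fun do rewrite mxE /=;
  solve [exact: cf|exact: cst_cont|exact: oppv_cont (cf _)].
Qed.

Lemma inv_k_continuous (X : topologicalType) (f : X -> R3) :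
  continuous f -> continuous (fun s => inv_k (f s)).
Proof.
move=> /row_continuousP cf; apply/mx_continuousP; do 2 apply: forall_ord4;
  under eq_fun do rewrite mxE /=;
  solve [exact: cf|exact: cst_cont|exact: oppv_cont (cf _)].
Qed.

(** For orthonormal [u] and [p] the two maps are commuting involutions, and
    this is the projection onto their common fixed space: the line of the
    quaternions whose rotation takes i to [u] and k to [p]. *)
Definition frame_proj u p : 'M[R]_4 :=
  4^-1 *: ((1%:M + inv_i u) *m (1%:M + inv_k p)).

Section Orthonormal.
Variables (u p : R3).
Hypotheses (u1 : dotp u u = 1) (p1 : dotp p p = 1) (up : dotp u p = 0).

Lemma frame_proj_idem : frame_proj u p *m frame_proj u p = frame_proj u p.
Proof.
rewrite /frame_proj -scalemxAl -scalemxAr scalerA.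
set A := inv_i u; set B := inv_k p.
have AA : (1%:M + A) *m (1%:M + A) = 2 *: (1%:M + A).
  rewrite mulmxDl !mulmxDr !mulmx1 !mul1mx inv_i_sqr// [A + 1%:M]addrC.
  by rewrite -mulr2n scaler_nat.
have BB : (1%:M + B) *m (1%:M + B) = 2 *: (1%:M + B).
  rewrite mulmxDl !mulmxDr !mulmx1 !mul1mx inv_k_sqr// [B + 1%:M]addrC.
  by rewrite -mulr2n scaler_nat.
have AB : (1%:M + A) *m (1%:M + B) = (1%:M + B) *m (1%:M + A).
  rewrite !(mulmxDl, mulmxDr, mulmx1, mul1mx) inv_ikC//.
  by rewrite -!addrA; congr (_ + _); rewrite addrCA.
rewrite {1}AB -mulmxA (mulmxA (1%:M + A)) AA -scalemxAl -scalemxAr AB.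
rewrite mulmxA BB -scalemxAl !scalerA -AB; congr (_ *: _).
by field.
Qed.

Lemma frame_proj_fix y : y *m frame_proj u p = y ->
  y *m inv_i u = y /\ y *m inv_k p = y.
Proof.
set K := frame_proj u p => yK.
have KA : K *m inv_i u = K.
  rewrite /K /frame_proj -scalemxAl -mulmxA [(_ + inv_k p) *m _]mulmxDl mul1mx.
  rewrite -inv_ikC// -[X in _ *m (X + _)]mulmx1 -mulmxDr mulmxA mulmxDl mul1mx.
  by rewrite inv_i_sqr// [_ + 1%:M]addrC.
have KB : K *m inv_k p = K.
  rewrite /K /frame_proj -scalemxAl -mulmxA [(_ + inv_k p) *m _]mulmxDl mul1mx.
  by rewrite inv_k_sqr// [_ + 1%:M]addrC.
by rewrite -yK -!mulmxA KA KB.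
Qed.

(** The trace is 1, since both involutions and their product are traceless. *)
Lemma frame_proj_neq0 : frame_proj u p != 0.
Proof.
apply/eqP => K0; have : \tr (frame_proj u p) = 0 by rewrite K0 mxtrace0.
move=> /eqP; rewrite /frame_proj mxtraceZ mulf_eq0 invr_eq0 pnatr_eq0 /=.
rewrite /mxtrace sum_ord4 !mxE !sum_ord4 !mxE /= ?mulr1n ?mulr0n => /eqP.
by lra.
Qed.

End Orthonormal.

(** The scalar product of [z] with the quaternion y k. *)
Definition pairing z y : R :=
  z 0 'i4 3 * y 0 'i4 0 - z 0 'i4 0 * y 0 'i4 3
  + z 0 'i4 1 * y 0 'i4 2 - z 0 'i4 2 * y 0 'i4 1.

Lemma pairingC z y : pairing z y = - pairing y z.
Proof. by rewrite /pairing; ring. Qed.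

Lemma pairing_continuous (X : topologicalType) (f g : X -> R4) :
  continuous f -> continuous g -> continuous (fun s => pairing (f s) (g s)).
Proof.
move=> /row_continuousP cf /row_continuousP cg; rewrite /pairing.
apply: addv_cont; [apply: addv_cont; [apply: addv_cont|]|];
  first [apply: mul_cont|apply: oppv_cont; apply: mul_cont];
  first [exact: cf|exact: cg].
Qed.

Lemma row4_neq0 y : y != 0 ->
  0 < y 0 'i4 0 ^+ 2 + y 0 'i4 1 ^+ 2 + y 0 'i4 2 ^+ 2 + y 0 'i4 3 ^+ 2.
Proof.
move=> y0; rewrite lt_neqAle eq_sym !addr_ge0 ?sqr_ge0// andbT.
apply: contra_neq y0 => s0; apply/rowP => i; rewrite mxE; apply/eqP.
rewrite -sqrf_eq0 eq_le sqr_ge0 andbT -s0; move: i.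
by apply: forall_ord4; move: (sqr_ge0 (y 0 'i4 0)) (sqr_ge0 (y 0 'i4 1))
  (sqr_ge0 (y 0 'i4 2)) (sqr_ge0 (y 0 'i4 3)); lra.
Qed.

(** Right multiplication by k turns a quaternion over the frame (u, p) into
    one over (- u, p), and quaternions over a given frame are proportional; so
    [z] is a multiple of y k. In coordinates: [z] is orthogonal to y, y i and
    y j, and Euler's four-square identity then expresses the square of the
    pairing as the product of the squared norms. *)
Lemma pairing_neq0 u p y z : dotp u u = 1 -> dotp p p = 1 ->
  y != 0 -> y *m inv_i u = y -> y *m inv_k p = y ->
  z != 0 -> z *m inv_i (- u) = z -> z *m inv_k p = z ->
  pairing z y != 0.
Proof.
rewrite !dotpE => u1 p1 y0 yu yp z0 zu zp.
have /= yyzz := mulr_gt0 (row4_neq0 y0) (row4_neq0 z0).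
(* the scalar products of [c] with the quaternions a, a i and a j; for
   [y] and [z] each of them is reversed by one of the two involutions *)
pose b0 (a c : R4) := a 0 'i4 0 * c 0 'i4 0 + a 0 'i4 1 * c 0 'i4 1
  + a 0 'i4 2 * c 0 'i4 2 + a 0 'i4 3 * c 0 'i4 3.
pose bi (a c : R4) := - a 0 'i4 1 * c 0 'i4 0 + a 0 'i4 0 * c 0 'i4 1
  + a 0 'i4 3 * c 0 'i4 2 - a 0 'i4 2 * c 0 'i4 3.
pose bj (a c : R4) := - a 0 'i4 2 * c 0 'i4 0 - a 0 'i4 3 * c 0 'i4 1
  + a 0 'i4 0 * c 0 'i4 2 + a 0 'i4 1 * c 0 'i4 3.
have H0 : b0 y z = 0.
  have : b0 (y *m inv_i u) (z *m inv_i (- u)) = - b0 y z.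
    rewrite -[RHS]mulr1 -u1 /b0 !mxE !sum_ord4 !mxE /=; ring.
  by rewrite yu zu; lra.
have Hi : bi y z = 0.
  have : bi (y *m inv_k p) (z *m inv_k p) = - bi y z.
    rewrite -[RHS]mulr1 -p1 /bi !mxE !sum_ord4 !mxE /=; ring.
  by rewrite yp zp; lra.
have Hj : bj y z = 0.
  have : bj (y *m inv_k p) (z *m inv_k p) = - bj y z.
    rewrite -[RHS]mulr1 -p1 /bj !mxE !sum_ord4 !mxE /=; ring.
  by rewrite yp zp; lra.
apply: contraTneq yyzz => P0; rewrite -leNgt le_eqVlt; apply/orP; left.
apply/eqP; transitivity (b0 y z ^+ 2 + bi y z ^+ 2 + bj y z ^+ 2 +
  pairing z y ^+ 2); last by rewrite H0 Hi Hj P0; ring.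
by rewrite /b0 /bi /bj /pairing; ring.
Qed.

End Quaternions.

(** * No odd frame on the sphere *)

Section NoOddFrame.
Context {R : realType}.
Local Notation R3 := 'rV[R]_3.
Local Notation S2 := (sphere R).

(** A path from the north pole which reaches [A] at time 1 when [A] lies on
    the equator; keeping the last coordinate nonnegative makes the path depend
    continuously on [A] over the whole sphere. *)
Definition meridian_vec (z : S2 * R) : R3 :=
  let t := clamp z.2 in
  let a := t * val z.1 0 'i3 0 in let b := t * val z.1 0 'i3 1 in
  row3 a b (Num.sqrt (1 - a ^+ 2 - b ^+ 2)).

Lemma meridian_sphere z : S2 (meridian_vec z).
Proof.
case: z => A t; apply/sphereE; rewrite /meridian_vec /=.
have := sphere_dotp A; have /andP[t0 t1] := clamp_itv t.
move: (clamp t) t0 t1 => {}t t0 t1.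
rewrite !dotpE !row3E; move: (val A 0 'i3 0) (val A 0 'i3 1) (val A 0 'i3 2).
move=> a b c abc; set s := Num.sqrt _.
have : s ^+ 2 = 1 - (t * a) ^+ 2 - (t * b) ^+ 2.
  rewrite sqr_sqrtr//.
  have -> : 1 - (t * a) ^+ 2 - (t * b) ^+ 2 =
    c ^+ 2 + (1 - t ^+ 2) * (a ^+ 2 + b ^+ 2) by rewrite -{1}abc; ring.
  rewrite addr_ge0 ?sqr_ge0// mulr_ge0 ?[0 <= a ^+ 2 + _]addr_ge0 ?sqr_ge0//.
  by rewrite subr_ge0 exprn_ile1.
by move=> ss; rewrite -[s * s]expr2 ss; ring.
Qed.

Definition meridian : S2 * R -> S2 := into meridian_sphere.

Lemma meridian_continuous : continuous meridian.
Proof.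
apply: into_continuous.
have cA : continuous (fun z : S2 * R => val z.1).
  exact: continuousT_comp fst_cont (@val_continuous _ S2).
have cc (i : 'I_3) : continuous (fun z : S2 * R => clamp z.2 * val z.1 0 i).
  apply: mul_cont; first exact: continuousT_comp snd_cont clamp_continuous.
  by move/row_continuousP: cA; exact.
apply: row3_continuous; [exact: cc..|].
by apply/sqrt_cont/addv_cont/oppv_cont/mul_cont => //; apply: addv_cont;
  [exact: cst_cont|exact/oppv_cont/mul_cont].
Qed.

Lemma meridian0 (A B : S2) : meridian (A, 0) = meridian (B, 0).
Proof.
by apply/val_inj; rewrite /= /meridian_vec/= clamp_id ?lexx ?ler01// !mul0r.
Qed.

Lemma meridian1 (A : S2) : val A 0 'i3 2 = 0 -> meridian (A, 1) = A.
Proof.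
move=> A2; apply/val_inj; rewrite /= /meridian_vec/= clamp_id ?lexx ?ler01//.
have := sphere_dotp A; rewrite dotpE A2 => A1.
apply/rowP; apply: forall_ord3; rewrite row3E ?mul1r// A2.
by rewrite -[X in Num.sqrt X](_ : 0 = _) ?sqrtr0// -{1}A1; ring.
Qed.

(** Half of the equator, from one point to its antipode; outside the interval
    from -1 to 1 the parameter is clamped. *)
Definition equator_vec (s : R) : R3 :=
  let s' := Num.max (-1) (Num.min 1 s) in row3 s' (Num.sqrt (1 - s' ^+ 2)) 0.

Lemma equator_sphere s : S2 (equator_vec s).
Proof.
apply/sphereE; rewrite /equator_vec /=.
have : -1 <= Num.max (-1) (Num.min 1 s) <= 1.
  by rewrite le_max lexx/= ge_max ge_min lexx andbT; lra.
move: (Num.max _ _) => {}s /andP[s0 s1]; rewrite dotpE !row3E -!expr2.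
rewrite sqr_sqrtr; first by ring.
by rewrite subr_ge0 -ler_sqrt// sqrtr1 sqrtr_sqr ler_norml s0.
Qed.

Definition equator : R -> S2 := into equator_sphere.

Lemma equator_continuous : continuous equator.
Proof.
apply: into_continuous.
have cm : continuous (fun s : R => Num.max (-1) (Num.min 1 s)).
  by apply/max_cont/min_cont; [exact: cst_cont..|exact: id_cont].
apply: row3_continuous; [exact: cm| |exact: cst_cont].
by apply/sqrt_cont/addv_cont; [exact: cst_cont|exact/oppv_cont/mul_cont].
Qed.

Lemma equator_opp : equator (-1) = antipode (equator 1).
Proof.
apply/val_inj; rewrite /= /equator_vec /=.
have le1 : -1 <= 1 :> R by lra.
rewrite minxx (min_r le1) (max_r le1).
rewrite maxxx sqrrN expr1n subrr sqrtr0.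
by apply/rowP; apply: forall_ord3; rewrite !mxE /= ?oppr0.
Qed.

(** The frames (u A, p A) are lifted to quaternions [y A] by transport along
    meridians. For [A] on the equator the frames at [A] and at its antipode
    differ by a half turn about [p], so the pairing of [y (antipode A)] with
    [y A] does not vanish. This pairing is odd in [A], because right
    multiplication by k is antisymmetric, and changes sign along half of the
    equator: a contradiction with the intermediate value theorem. *)
Theorem no_odd_frame (u p : S2 -> R3) :
  continuous u -> continuous p ->
  (forall A, [/\ dotp (u A) (u A) = 1, dotp (p A) (p A) = 1 &
                 dotp (u A) (p A) = 0]) ->
  (forall A, u (antipode A) = - u A) -> (forall A, p (antipode A) = p A) ->
  False.
Proof.
move=> cu cp ON oddu evenp.
pose K z := frame_proj (u (meridian z)) (p (meridian z)).
have cK : continuous K.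
  apply: scale_cont; first exact: cst_cont.
  have H (f : S2 -> R3) : continuous f -> continuous (fun z => f (meridian z)).
    by move=> cf; exact: continuousT_comp meridian_continuous cf.
  apply: mulmx_continuous; apply: addv_cont; try exact: cst_cont.
    exact/inv_i_continuous/H.
  exact/inv_k_continuous/H.
have idK z : K z *m K z = K z.
  by have [u1 p1 up] := ON (meridian z); exact: frame_proj_idem.
have [T [cT HT]] := idempotent_transport sphere_compactT cK idK.
pose A0 := equator 1.
have [y0 y0_neq0 y0K] : exists2 y0 : 'rV[R]_4, y0 != 0 & y0 *m K (A0, 0) = y0.
  have : K (A0, 0) != 0.
    by have [u1 p1 up] := ON (meridian (A0, 0)); exact: frame_proj_neq0.
  case/matrix0Pn => i [j Kij]; exists (row i (K (A0, 0))).
    by apply: contraNneq Kij => /rowP/(_ j); rewrite !mxE => ->.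
  by rewrite -row_mul idK.
pose y (A : S2) := y0 *m T A.
have cy : continuous y by apply: mulmx_continuous => //; exact: cst_cont.
have Hy A : y A != 0 /\ y A *m K (A, 1) = y A.
  apply: HT => //; rewrite -[RHS]y0K; congr (_ *m _).
  by rewrite /K (meridian0 A A0).
pose phi (A : S2) := pairing (y (antipode A)) (y A).
have phi_neq0 (A : S2) : val A 0 'i3 2 = 0 -> phi A != 0.
  move=> A2; have [u1 p1 up] := ON A.
  have [yA yAK] := Hy A; have [yB yBK] := Hy (antipode A).
  move: yAK yBK; rewrite /K !meridian1//; last by rewrite /= mxE A2 oppr0.
  move=> /(frame_proj_fix u1 p1 up) [yu yp].
  have [u1' p1' up'] := ON (antipode A).
  move=> /(frame_proj_fix u1' p1' up'); rewrite oddu evenp => -[zu zp].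
  exact: (pairing_neq0 u1 p1 yA yu yp yB zu zp).
pose g s := phi (equator s).
have cg : continuous g.
  apply: continuousT_comp equator_continuous _.
  apply: pairing_continuous => //.
  exact: continuousT_comp antipode_continuous cy.
have gN : g (-1) = - g 1.
  by rewrite /g equator_opp /phi antipodeK pairingC.
have le1 : -1 <= 1 :> R by lra.
have g0 : Num.min (g (-1)) (g 1) <= 0 <= Num.max (g (-1)) (g 1).
  rewrite gN ge_min le_max; case: (leP 0 (g 1)) => [g1|/ltW g1].
    by rewrite oppr_le0 g1 orbT.
  by rewrite oppr_ge0 g1 ?orbT.
have [s _ gs0] := IVT le1 (continuous_subspaceT cg) g0.
suff : phi (equator s) != 0 by rewrite -/(g s) gs0 eqxx.
by apply: phi_neq0; rewrite /= row3E.
Qed.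

End NoOddFrame.

(** * Pairs of points of the sphere as complex lines *)

Lemma block_mx_continuous (R : realType) (X : topologicalType) m1 m2 n1 n2
    (A : X -> 'M[R]_(m1, n1)) (B : X -> 'M[R]_(m1, n2))
    (C : X -> 'M[R]_(m2, n1)) (D : X -> 'M[R]_(m2, n2)) :
  continuous A -> continuous B -> continuous C -> continuous D ->
  continuous (fun s => block_mx (A s) (B s) (C s) (D s)).
Proof.
move=> /mx_continuousP cA /mx_continuousP cB /mx_continuousP cC.
move=> /mx_continuousP cD; apply/mx_continuousP => i j.
rewrite (_ : (fun s => _) = fun s => match fintype.split i, fintype.split j with
  | inl k, inl l => A s k l | inl k, inr l => B s k l
  | inr k, inl l => C s k l | inr k, inr l => D s k l end).
  case: (fintype.split i) => k; case: (fintype.split j) => l;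
    [exact: cA|exact: cB|exact: cC|exact: cD].
apply/funext => s; rewrite /block_mx mxE.
by case: (fintype.split i) => k; rewrite mxE.
Qed.

Section PairProjection.
Context {R : realType}.
Local Notation R3 := 'rV[R]_3.
Implicit Types (p q v a b : R3).

(** The product [a *m cross_mx v] is the cross product of [v] and [a]. *)
Definition cross_mx v : 'M[R]_3 :=
  let v0 := v 0 'i3 0 in let v1 := v 0 'i3 1 in let v2 := v 0 'i3 2 in
  mx_of_rows 3 3 [:: [:: 0; v2; - v1]; [:: - v2; 0; v0]; [:: v1; - v0; 0]].

(** Complex 3-space is seen as the space of pairs (real part, imaginary part),
    and [pair_mx p q] is the Hermitian matrix with real part [pair_sym p q] and
    imaginary part [pair_skew p q]. For unit vectors it has rank one and nonzero
    eigenvalue [pair_eig p q]. Its range is the point of the complex projective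
    plane that represents the unordered pair: with the sphere seen as the
    complex projective line, it is the line of the quadratic forms whose roots
    are [p] and [q]. *)
Definition pair_sym p q : 'M[R]_3 :=
  ((1 + dotp p q) / 2) *: 1%:M - 2^-1 *: (p^T *m q + q^T *m p).

Definition pair_skew p q : 'M[R]_3 := cross_mx (2^-1 *: (p + q)).

Definition pair_mx p q : 'M[R]_(3 + 3) :=
  block_mx (pair_sym p q) (pair_skew p q) (- pair_skew p q) (pair_sym p q).

Definition pair_eig p q : R := (3 + dotp p q) / 2.

Definition pair_proj p q : 'M[R]_(3 + 3) := (pair_eig p q)^-1 *: pair_mx p q.

Lemma pair_projC p q : pair_proj p q = pair_proj q p.
Proof.
rewrite /pair_proj /pair_mx /pair_eig /pair_sym /pair_skew (dotpC p).
by rewrite (addrC p) (addrC (p^T *m q)).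
Qed.

Lemma pair_eig_gt0 p q : dotp p p = 1 -> dotp q q = 1 -> 0 < pair_eig p q.
Proof.
move=> p1 q1; have := dotp_ge0 (p + q).
by rewrite dotpDl !dotpDr p1 q1 (dotpC q) /pair_eig; lra.
Qed.

Lemma pair_symE p q i j : pair_sym p q i j =
  (1 + dotp p q) / 2 * (i == j)%:R - 2^-1 * (p 0 i * q 0 j + q 0 i * p 0 j).
Proof. by rewrite !mxE !big_ord1 !mxE. Qed.

(** Off the unit sphere the two sides differ by a combination of the defects
    |p|^2 - 1 and |q|^2 - 1, given explicitly in the proof. *)
Lemma pair_mx_sqr p q : dotp p p = 1 -> dotp q q = 1 ->
  pair_mx p q *m pair_mx p q = pair_eig p q *: pair_mx p q.
Proof.
rewrite !dotpE => p1 q1.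
have Hs : pair_sym p q *m pair_sym p q - pair_skew p q *m pair_skew p q =
    pair_eig p q *: pair_sym p q.
  apply/matrixP => i j; apply/eqP; rewrite -subr_eq0; apply/eqP.
  transitivity (4^-1 * ((dotp q q - 1) * (p 0 i * p 0 j) +
    (dotp p p - 1) * (q 0 i * q 0 j) +
    (dotp p p + dotp q q - 2) * (i == j)%:R)); last first.
    by rewrite !dotpE p1 q1; ring.
  rewrite !(pair_symE, sum_ord3, mxE) /pair_eig !dotpE; move: i j.
  by do 2 apply: forall_ord3; rewrite /= ?mxE /=; field.
have Hk : pair_sym p q *m pair_skew p q + pair_skew p q *m pair_sym p q =
    pair_eig p q *: pair_skew p q.
  apply/matrixP => i j; apply/eqP; rewrite -subr_eq0; apply/eqP.
  transitivity (4^-1 * ((dotp q q - 1) * cross_mx p i j +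
    (dotp p p - 1) * cross_mx q i j)); last by rewrite !dotpE p1 q1; ring.
  rewrite !(pair_symE, sum_ord3, mxE) /pair_eig !dotpE; move: i j.
  by do 2 apply: forall_ord3; rewrite /= ?mxE /=; field.
rewrite /pair_mx mulmx_block scale_block_mx -Hs -Hk scalerN.
set S := pair_sym p q; set K := pair_skew p q.
congr block_mx; rewrite ?mulmxN ?mulNmx//; last by rewrite addrC.
by rewrite -Hk -opprD addrC.
Qed.

Lemma pair_proj_idem p q : dotp p p = 1 -> dotp q q = 1 ->
  pair_proj p q *m pair_proj p q = pair_proj p q.
Proof.
move=> p1 q1; have l0 := lt0r_neq0 (pair_eig_gt0 p1 q1).
rewrite /pair_proj -scalemxAl -scalemxAr pair_mx_sqr// scalerA.
by rewrite [X in X *: _ = _](_ : _ = (pair_eig p q)^-1 * (pair_eig p q)^-1) //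
  scalerA -mulrA mulVf// mulr1.
Qed.

Lemma pair_proj_continuous (X : topologicalType) (f g : X -> R3) :
  (forall s, dotp (f s) (f s) = 1) -> (forall s, dotp (g s) (g s) = 1) ->
  continuous f -> continuous g -> continuous (fun s => pair_proj (f s) (g s)).
Proof.
move=> f1 g1 cf cg.
have ccross (h : X -> R3) :
    continuous h -> continuous (fun s => cross_mx (h s)).
  move=> /row_continuousP ch; apply/mx_continuousP; do 2 apply: forall_ord3;
    under eq_fun do rewrite mxE /=;
    solve [exact: ch|exact: cst_cont|exact: oppv_cont (ch _)].
have ctr (h : X -> R3) : continuous h -> continuous (fun s => (h s)^T).
  move=> /mx_continuousP ch; apply/mx_continuousP => i j.
  by under eq_fun do rewrite mxE; exact: ch.
have cS : continuous (fun s => pair_sym (f s) (g s)).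
  apply: addv_cont; last apply: oppv_cont.
    apply: scale_cont; last exact: cst_cont.
    apply: mul_cont; last exact: cst_cont.
    by apply: addv_cont; [exact: cst_cont|exact: dotp_continuous].
  apply: scale_cont; first exact: cst_cont.
  by apply: addv_cont; apply: mulmx_continuous => //; exact: ctr.
have cK : continuous (fun s => pair_skew (f s) (g s)).
  by apply/ccross/scale_cont/addv_cont => //; exact: cst_cont.
apply: scale_cont.
  apply: inv_cont => [|s]; last exact/lt0r_neq0/pair_eig_gt0.
  apply: mul_cont; last exact: cst_cont.
  by apply: addv_cont; [exact: cst_cont|exact: dotp_continuous].
exact: (block_mx_continuous cS cK (oppv_cont cK) cS).
Qed.

(** For a unit vector [a], the mirror image of [q] in the plane orthogonal
    to [a]. *)
Definition mirror q a : R3 := q - (2 * dotp q a) *: a.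

Lemma mirror_sphere q a : dotp q q = 1 -> dotp a a = 1 ->
  dotp (mirror q a) (mirror q a) = 1.
Proof.
move=> q1 a1; rewrite /mirror dotpBl !dotpBr !dotpZl !dotpZr q1 a1 (dotpC a).
by ring.
Qed.

(** For distinct unit vectors [p] and [q] the line of the pair is spanned by
    (p - q) - i p x q. When [p] is the mirror image of [q] this vector is a
    multiple of a + i q x a, which still spans the line when [p = q]. The latter
    vector is odd in [a], whereas the mirror image is even. *)
Lemma mirror_fix q a : dotp q q = 1 -> dotp a a = 1 ->
  let w := row_mx a (a *m cross_mx q) in
  w *m pair_proj (mirror q a) q = w.
Proof.
move=> q1 a1 w; have l0 := lt0r_neq0 (pair_eig_gt0 (mirror_sphere q1 a1) q1).
suff wM : w *m pair_mx (mirror q a) q = pair_eig (mirror q a) q *: w.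
  by rewrite -scalemxAr wM scalerA mulVf// scale1r.
rewrite mul_row_block scale_row_mx; congr row_mx.
  apply/rowP => j; apply/eqP; rewrite -subr_eq0; apply/eqP.
  transitivity ((dotp q q - 1) * a 0 j -
    2 * dotp q a * (1 - dotp a a) * q 0 j); last by rewrite q1 a1; ring.
  rewrite !(pair_symE, sum_ord3, mxE) /pair_eig /mirror !dotpE; move: j.
  by apply: forall_ord3; rewrite /= ?mxE /= ?dotpE; field.
apply/rowP => j; apply/eqP; rewrite -subr_eq0; apply/eqP.
rewrite !(pair_symE, sum_ord3, mxE) /pair_eig /mirror !dotpE; move: j.
by apply: forall_ord3; rewrite /= ?mxE /= ?dotpE; field.
Qed.

(** The line of the pair [p], [p] consists of the vectors a + i p x a with [a]
    orthogonal to [p]. *)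
Lemma pair_proj_diag p a b : dotp p p = 1 ->
  row_mx a b *m pair_proj p p = row_mx a b -> row_mx a b != 0 ->
  a != 0 /\ dotp a p = 0.
Proof.
move=> p1; have p2 : pair_eig p p = 2 by rewrite /pair_eig p1; field.
rewrite /pair_proj p2 -scalemxAr => /(congr1 ( *:%R 2)) + w0.
rewrite scalerA divff ?pnatr_eq0// scale1r.
have Sp c : c *m pair_sym p p = c - dotp c p *: p.
  rewrite /pair_sym p1 mulmxBr (_ : (1 + 1) / 2 = 1); last by field.
  rewrite scale1r mulmx1; congr (_ - _); apply/rowP => j.
  by rewrite -scalemxAr !mxE sum_ord3 !mxE !big_ord1 !mxE dotpE; field.
have Kp : pair_skew p p = cross_mx p.
  rewrite /pair_skew (_ : p + p = 2 *: p); last by rewrite scaler_nat mulr2n.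
  by rewrite scalerA mulVf ?pnatr_eq0// scale1r.
rewrite mul_row_block scale_row_mx !Sp Kp => /eq_row_mx [Ha Hb].
have orth c : dotp (c *m cross_mx p) p = 0.
  by rewrite dotpE !mxE !sum_ord3 !mxE /=; ring.
have ap : dotp a p = 0.
  have := congr1 (fun c => dotp c p) Ha.
  by rewrite dotpDl dotpBl !dotpZl p1 mulmxN dotpNl orth; lra.
split => //; apply: contra_neq w0 => a0; rewrite a0 in Hb *.
have bp : dotp b p = 0.
  have := congr1 (fun c => dotp c p) Hb.
  by rewrite dotpDl dotpBl !dotpZl p1 orth; lra.
move: Hb; rewrite mul0mx add0r bp scale0r subr0 => /eqP.
rewrite -subr_eq0 -{1}[b]scale1r -scalerBl scaler_eq0 => /orP[|/eqP->].
  by rewrite (_ : 1 - 2 = -1) ?oppr_eq0 ?oner_eq0//; ring.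
by rewrite row_mx0.
Qed.

End PairProjection.

(** * Unordered pairs of points *)

Section UnorderedPairs.
Local Open Scope quotient_scope.

Lemma upair_continuous (X Y : topologicalType) (f g : X -> Y) :
  continuous f -> continuous g -> continuous (fun x => upair (f x) (g x)).
Proof.
move=> cf cg; exact: continuousT_comp (continuous_pair cf cg) pi_continuous.
Qed.

Lemma upair_lift (Y Z : topologicalType) (h : Y * Y -> Z) :
  continuous h -> (forall p q, h (p, q) = h (q, p)) ->
  exists2 h' : upairs Y -> Z, continuous h' &
    forall p q, h' (upair p q) = h (p, q).
Proof.
move=> ch hC.
have hE (a b : Y * Y) : \pi_(upairs Y) a = \pi_(upairs Y) b -> h a = h b.
  by move=> /eqmodP /orP[/eqP->|/eqP->]//; rewrite hC; case: b.
exists (h \o repr); last by move=> p q; apply: hE; rewrite reprK.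
apply/quotient_continuous => x.
rewrite (_ : _ \o _ = h); first exact: ch.
by apply/funext => y /=; apply: hE; rewrite reprK.
Qed.

End UnorderedPairs.

Section NotDiagonal.
Context {R : realType}.
Local Notation R3 := 'rV[R]_3.
Local Notation S2 := (sphere R).
Variables (Y : topologicalType) (g : Y -> S2) (e : S2 -> Y) (y0 : Y).
Hypotheses (cg : continuous g) (eK : forall x, g (e x) = x).

Let q : R3 := val (g y0).
Let q1 : dotp q q = 1. Proof. exact: sphere_dotp. Qed.

Lemma fold_sphere (A : S2) : S2 (mirror q (val A)).
Proof. by apply/sphereE/mirror_sphere => //; exact: sphere_dotp. Qed.

Let fold : S2 -> S2 := into fold_sphere.

Let fold_continuous : continuous fold.
Proof.
apply: into_continuous; apply: addv_cont; first exact: cst_cont.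
apply/oppv_cont/scale_cont; last exact: val_continuous.
apply: mul_cont; first exact: cst_cont.
by apply: dotp_continuous; [exact: cst_cont|exact: val_continuous].
Qed.

Let fold_antipode A : fold (antipode A) = fold A.
Proof.
by apply/val_inj; rewrite /= /mirror dotpNr mulrN scaleNr scalerN opprK.
Qed.

(** In the complex projective plane of unordered pairs, the first map has
    degree 1 while a map into the diagonal, a conic, has even degree. The
    parity is detected as follows. The map [fold] identifies antipodes, and the
    line over the pair of [fold A] and [y0] carries the odd section [w0] of
    [mirror_fix]. Transport along the two homotopies makes it an odd section
    [w] over the diagonal pairs, whose real part is an odd nowhere zero field
    orthogonal to the even field [p], against [no_odd_frame]. *)
Theorem upair_cst_not_diag (phi : S2 -> upairs Y) (f : S2 -> Y) :
  continuous f ->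
  homotopic R phi (fun x => upair (e x) y0) ->
  homotopic R phi (fun x => upair (f x) (f x)) ->
  False.
Proof.
move=> cf /homotopic_sym hom1 hom2.
have [|p p'|E cE EE] := @upair_lift Y _
    (fun z : Y * Y => pair_proj (val (g z.1)) (val (g z.2))).
- apply: pair_proj_continuous => [s|s||]; [exact: sphere_dotp..| |].
    by apply/continuous_val; exact: continuousT_comp fst_cont cg.
  by apply/continuous_val; exact: continuousT_comp snd_cont cg.
- exact: pair_projC.
have idE P : E P *m E P = E P.
  elim/quotW: P => -[p p'] /=; rewrite -/(upair p p') EE.
  by rewrite pair_proj_idem//; exact: sphere_dotp.
have [T1 [cT1 HT1]] := homotopic_transport sphere_compactT cE idE hom1.
have [T2 [cT2 HT2]] := homotopic_transport sphere_compactT cE idE hom2.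
pose w0 (A : S2) : 'rV[R]_(3 + 3) := row_mx (val A) (val A *m cross_mx q).
pose w (A : S2) := w0 A *m T1 (fold A) *m T2 (fold A).
have w0_neq0 (A : S2) : w0 A != 0.
  apply/eqP; rewrite -[RHS]row_mx0 => /eq_row_mx [A0 _].
  have /eqP := sphere_dotp A; rewrite A0 (eqP (_ : dotp 0 0 == 0)) ?dotp_eq0//.
  by rewrite eq_sym oner_eq0.
have Hw (A : S2) : w A != 0 /\
    w A *m pair_proj (val (g (f (fold A)))) (val (g (f (fold A)))) = w A.
  have [|v0 vE] := HT1 (fold A) (w0 A) (w0_neq0 A).
    rewrite EE eK; exact: mirror_fix (sphere_dotp _).
  by have := HT2 (fold A) _ v0 vE; rewrite EE.
have cw : continuous w.
  have cfold n (T : S2 -> 'M[R]_n) : continuous T ->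
      continuous (fun A : S2 => T (fold A)).
    by move=> cT; exact: continuousT_comp fold_continuous cT.
  apply: mulmx_continuous (cfold _ _ cT2).
  apply: mulmx_continuous (cfold _ _ cT1).
  have cC : continuous (fun A : S2 => val A *m cross_mx q).
    by apply: mulmx_continuous; [exact: val_continuous|exact: cst_cont].
  apply/row_continuousP => j.
  rewrite (_ : (fun A : S2 => _) = fun A : S2 => match fintype.split j with
    | inl k => val A 0 k | inr k => (val A *m cross_mx q) 0 k end).
    case: (fintype.split j) => k; last by move/row_continuousP : cC; exact.
    by move: (@val_continuous _ S2) => /row_continuousP; exact.
  by apply/funext => A; rewrite mxE.
pose a (A : S2) := lsubmx (w A).
pose p (A : S2) := val (g (f (fold A))).
have ap (A : S2) : a A != 0 /\ dotp (a A) (p A) = 0.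
  have [w_neq0 wE] := Hw A; rewrite -[w A]hsubmxK in w_neq0 wE.
  exact: pair_proj_diag (sphere_dotp _) wE w_neq0.
have ca : continuous a.
  apply/row_continuousP => j; move/row_continuousP : cw => cw.
  rewrite (_ : (fun A : S2 => _) = fun A : S2 => w A 0 (lshift 3 j)).
    exact: cw.
  by apply/funext => A; rewrite mxE.
have an0 (A : S2) : dotp (a A) (a A) != 0 by rewrite dotp_eq0; case: (ap A).
apply: (@no_odd_frame R
  (fun A : S2 => (Num.sqrt (dotp (a A) (a A)))^-1 *: a A) p).
- apply: scale_cont => //; apply: inv_cont => [|A].
    by apply: sqrt_cont; exact: dotp_continuous.
  by rewrite sqrtr_eq0 -ltNge lt_neqAle eq_sym an0 dotp_ge0.
- apply/continuous_val; apply: continuousT_comp _ cg.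
  exact: continuousT_comp fold_continuous cf.
- move=> A; have [_ apA] := ap A; split; last by rewrite dotpZl apA mulr0.
    rewrite dotpZl dotpZr mulrA -invfM -expr2 sqr_sqrtr ?dotp_ge0//.
    by rewrite mulVf.
  exact: sphere_dotp.
- move=> A; rewrite (_ : a (antipode A) = - a A).
    by rewrite dotpNl dotpNr opprK scalerN.
  rewrite /a /w fold_antipode -linearN -!mulNmx; congr (lsubmx (_ *m _ *m _)).
  by rewrite /w0 /= mulNmx -opp_row_mx.
- by move=> A; rewrite /p fold_antipode.
Qed.

End NotDiagonal.

(** * Gauge of a convex body *)

Lemma convex_set_comb (R : realType) (V : lmodType R) (A : set V) x y t :
  convex_set A -> A x -> A y -> 0 <= t <= 1 -> A (t *: x + (1 - t) *: y).
Proof.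
move=> cA Ax Ay /andP[t0 t1].
by have := cA x y (Itv01 t0 t1) (mem_set Ax) (mem_set Ay); rewrite inE.
Qed.

Section Gauge.
Context {R : realType} {V : normedModType R} (K : set V) (o : V).
Hypotheses (K_compact : compact K) (K_convex : convex_set K) (Ko : K° o).

Definition gauge_set (y : V) : set R := [set s | 0 < s /\ K (o + s^-1 *: y)].
(** The Minkowski functional of [K] seen from [o]. *)
Definition gauge (y : V) : R := inf (gauge_set y).

Let Koo : K o. Proof. exact: interior_subset Ko. Qed.

Lemma gauge_set_up y s s' : gauge_set y s -> s <= s' -> gauge_set y s'.
Proof.
move=> [s0 Ks] ss'; have s'0 : 0 < s' by exact: lt_le_trans ss'.
split => //; have -> : o + s'^-1 *: y =
    (s / s') *: (o + s^-1 *: y) + (1 - s / s') *: o.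
  rewrite scalerDr scalerA mulrAC divff ?gt_eqF// mul1r scalerBl scale1r.
  by rewrite addrAC [_ + (o - _)]addrC subrK.
apply: convex_set_comb => //.
by rewrite divr_ge0 ?(ltW s0) ?(ltW s'0)//= ler_pdivrMr// mul1r.
Qed.

Lemma gauge_has_radius : exists2 r, 0 < r & forall d, `|d| < r -> K (o + d).
Proof.
have /nbhs_ballP [r /= r0 Kr] := Ko.
by exists r => // d dr; apply: Kr; rewrite -ball_normE /= opprD addNKr normrN.
Qed.

Lemma gauge_set_large r y s : (forall d, `|d| < r -> K (o + d)) -> 0 < s ->
  `|y| < s * r -> gauge_set y s.
Proof.
move=> Kr s0 ysr; split => //; apply: Kr.
by rewrite normrZ normfV gtr0_norm// mulrC ltr_pdivrMr// mulrC.
Qed.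

Lemma gauge_has_inf y : has_inf (gauge_set y).
Proof.
split; last by exists 0 => s [/ltW].
have [r r0 Kr] := gauge_has_radius.
have yr : 0 < (`|y| + 1) / r by rewrite divr_gt0// ltr_wpDl.
exists ((`|y| + 1) / r); apply: (gauge_set_large Kr) => //.
by rewrite divfK ?gt_eqF// ltrDl.
Qed.

Lemma gauge_le y s : gauge_set y s -> gauge y <= s.
Proof. by move=> ys; apply: ge_inf => //; exact: (gauge_has_inf y).2. Qed.

Lemma gauge_lt y s : gauge y < s -> gauge_set y s.
Proof.
move=> /inf_lt -/(_ (gauge_has_inf y).1) [t yt ts].
exact: gauge_set_up yt (ltW ts).
Qed.

Lemma gauge_ge0 y : 0 <= gauge y.
Proof. by apply: lb_le_inf; [exact: (gauge_has_inf y).1|move=> s [/ltW]]. Qed.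

Lemma gaugeD x y : gauge (x + y) <= gauge x + gauge y.
Proof.
apply/ler_addgt0Pr => e e0.
have e2 : 0 < e / 2 by rewrite divr_gt0.
have [s0 Ks] : gauge_set x (gauge x + e / 2) by apply: gauge_lt; rewrite ltrDl.
have [t0 Kt] : gauge_set y (gauge y + e / 2) by apply: gauge_lt; rewrite ltrDl.
rewrite [e]splitr addrACA; set s := _ + e / 2 in s0 Ks *.
set t := _ + e / 2 in t0 Kt *.
have st0 : 0 < s + t by rewrite addr_gt0.
apply: gauge_le; split => //.
have -> : o + (s + t)^-1 *: (x + y) = (s / (s + t)) *: (o + s^-1 *: x) +
    (1 - s / (s + t)) *: (o + t^-1 *: y).
  have -> : 1 - s / (s + t) = t / (s + t) by field; rewrite gt_eqF.
  rewrite !scalerDr !scalerA [RHS]addrACA -[in RHS]scalerDl -mulrDl.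
  rewrite divff ?gt_eqF// scale1r.
  by congr (_ + (_ *: _ + _ *: _)); field; rewrite ?gt_eqF.
apply: convex_set_comb => //.
by rewrite divr_ge0 ?(ltW s0) ?(ltW st0)//= ler_pdivrMr// mul1r lerDl ltW.
Qed.

Lemma gauge0 : gauge 0 = 0.
Proof.
apply/eqP; rewrite eq_le gauge_ge0 andbT; apply/ler_addgt0Pr => e e0.
by rewrite add0r; apply: gauge_le; split => //; rewrite scaler0 addr0.
Qed.

Lemma gaugeZ c y : 0 <= c -> gauge (c *: y) = c * gauge y.
Proof.
have H a z : 0 < a -> gauge (a *: z) <= a * gauge z.
  move=> a0; rewrite -ler_pdivrMl//; apply: lb_le_inf.
    exact: (gauge_has_inf z).1.
  move=> s [s0 Ks]; rewrite ler_pdivrMl//; apply: gauge_le; split.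
    exact: mulr_gt0.
  by rewrite scalerA invfM mulrAC mulVf ?gt_eqF// mul1r.
rewrite le_eqVlt => /predU1P[<-|c0]; first by rewrite scale0r mul0r gauge0.
apply/eqP; rewrite eq_le H//= -ler_pdivlMl//.
rewrite -{1}[y](_ : c^-1 *: (c *: y) = _); last first.
  by rewrite scalerA mulVf ?gt_eqF// scale1r.
by apply: H; rewrite invr_gt0.
Qed.

Lemma gauge_le_norm : exists2 C, 0 < C & forall y, gauge y <= C * `|y|.
Proof.
have [r r0 Kr] := gauge_has_radius.
exists r^-1; first by rewrite invr_gt0.
move=> y; apply/ler_addgt0Pr => e e0; apply: gauge_le.
have s0 : 0 < r^-1 * `|y| + e by rewrite ltr_wpDl// mulr_ge0// ltW// invr_gt0.
apply: (gauge_set_large Kr) => //.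
by rewrite mulrDl mulrAC mulVf ?gt_eqF// mul1r ltrDl mulr_gt0.
Qed.

Lemma gauge_continuous : continuous gauge.
Proof.
have [C C0 HC] := gauge_le_norm.
have H x y : gauge x <= gauge y + C * `|x - y|.
  by rewrite -{1}(subrKC y x) (le_trans (gaugeD _ _))// lerD2l HC.
apply: (@continuous_dominated _ _ _ (fun x y => C * `|x - y|)) => [x|x|x y].
- apply: mul_cont; first exact: cst_cont.
  move=> y; apply: cvg_norm; move: y.
  by apply: addv_cont; [exact: cst_cont|exact/oppv_cont/id_cont].
- by rewrite subrr normr0 mulr0.
- by rewrite ler_distl lerBlDr {1}distrC !H.
Qed.

Lemma gauge_eq0 y : gauge y = 0 -> y = 0.
Proof.
move=> y0; have /ex_strict_bound_gt0 [M M0 HM] : bounded_set K.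
  exact: compact_bounded.
have Hd d : K (o + d) -> `|d| < M + M.
  move=> Kd; rewrite -(addKr o d) (le_lt_trans (ler_normD _ _))// normrN.
  by rewrite ltrD// HM.
apply/eqP; rewrite -normr_le0; apply/ler_addgt0Pr => e e0; rewrite add0r.
have s0 : 0 < e / (M + M) by rewrite divr_gt0// addr_gt0.
have [_ /Hd] : gauge_set y (e / (M + M)) by apply: gauge_lt; rewrite y0.
rewrite normrZ normfV gtr0_norm// mulrC ltr_pdivrMr// mulrC.
by rewrite divfK ?gt_eqF ?addr_gt0// => /ltW.
Qed.

Lemma gaugeP y : K (o + y) <-> gauge y <= 1.
Proof.
split=> [Ky|y1]; first by apply: gauge_le; split => //; rewrite invr1 scale1r.
have cK : closed K by apply: compact_closed => //; exact: norm_hausdorff.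
apply: cK => B /nbhs_ballP [e /= e0 Be].
have y10 : 0 < `|y| + 1 by rewrite ltr_wpDl.
pose d := e / (`|y| + 1); have d0 : 0 < d by rewrite divr_gt0.
have [s0 Ks] : gauge_set y (1 + d).
  by apply: gauge_lt; rewrite (le_lt_trans y1)// ltrDl.
exists (o + (1 + d)^-1 *: y); split => //; apply: Be.
rewrite -ball_normE /= opprD addrACA subrr add0r -{1}[y]scale1r.
rewrite -scalerBl normrZ.
have -> : 1 - (1 + d)^-1 = d / (1 + d) by field; rewrite gt_eqF.
rewrite ger0_norm; last by rewrite divr_ge0 ?ltW.
rewrite (@le_lt_trans _ _ (d * `|y|))//.
  rewrite ler_wpM2r// ler_pdivrMr// ler_peMr ?ltW//.
  by rewrite ltrDl.
by rewrite /d mulrAC ltr_pdivrMr// ltr_pM2l// ltrDl.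
Qed.

Lemma gauge_interior y : K° (o + y) <-> gauge y < 1.
Proof.
split=> [/nbhs_ballP [e /= e0 Be]|y1].
  have y10 : 0 < `|y| + 1 by rewrite ltr_wpDl.
  pose d := e / (`|y| + 1); have d0 : 0 < d by rewrite divr_gt0.
  have : K (o + (1 + d) *: y).
    apply: Be; rewrite -ball_normE /= opprD addrACA subrr add0r.
    rewrite scalerDl scale1r opprD addNKr normrN normrZ gtr0_norm//.
    by rewrite /d mulrAC ltr_pdivrMr// ltr_pM2l// ltrDl.
  move=> /gaugeP; rewrite gaugeZ; last by rewrite addr_ge0// ltW.
  rewrite mulrC -ler_pdivlMr ?addr_gt0// => /le_lt_trans; apply.
  by rewrite mul1r invf_lt1 ?addr_gt0// ltrDl.
have : \forall z \near o + y, gauge (z - o) < 1.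
  have : {for o + y, continuous (fun z => gauge (z - o))}.
    apply: continuousT_comp gauge_continuous _.
    by apply: addv_cont; [exact: id_cont|exact: cst_cont].
  move=> /(_ [set s | s < 1]); apply => /=.
  rewrite addrC addKr.
  by apply: open_nbhs_nbhs; split => //; exact: open_lt.
apply: filterS => z /ltW; rewrite -{2}(subrKC o z) => z1.
exact/gaugeP.
Qed.

End Gauge.

(** * Sweepouts of a convex body by short pairs *)

Section EuclideanNorm.
Context {R : realType}.
Local Notation R3 := 'rV[R]_3.
Implicit Types x y : R3.

Lemma eucl_norm_ge0 x : 0 <= eucl_norm x.
Proof. exact: sqrtr_ge0. Qed.

Lemma eucl_norm_sqr x : eucl_norm x ^+ 2 = dotp x x.
Proof. by rewrite sqr_sqrtr// dotp_ge0. Qed.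

Lemma eucl_normZ a x : eucl_norm (a *: x) = `|a| * eucl_norm x.
Proof.
by rewrite /eucl_norm dotpZl dotpZr mulrA -expr2 sqrtrM ?sqr_ge0// sqrtr_sqr.
Qed.

Lemma eucl_norm_eq0 x : (eucl_norm x == 0) = (x == 0).
Proof. by rewrite -dotp_eq0 -eucl_norm_sqr sqrf_eq0. Qed.

Lemma cauchy_schwarz x y : dotp x y <= eucl_norm x * eucl_norm y.
Proof.
rewrite (le_trans (ler_norm _))// -sqrtr_sqr -sqrtrM ?dotp_ge0// ler_sqrt.
  rewrite -subr_ge0 !dotpE; set a := x 0 'i3 0; set b := x 0 'i3 1.
  set c := x 0 'i3 2; set a' := y 0 'i3 0; set b' := y 0 'i3 1.
  set c' := y 0 'i3 2.
  have -> : (a * a + b * b + c * c) * (a' * a' + b' * b' + c' * c') -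
    (a * a' + b * b' + c * c') ^+ 2 =
    (a * b' - b * a') ^+ 2 + (a * c' - c * a') ^+ 2 + (b * c' - c * b') ^+ 2.
    by ring.
  by rewrite !addr_ge0 ?sqr_ge0.
by rewrite mulr_ge0 ?dotp_ge0.
Qed.

Lemma eucl_normD x y : eucl_norm (x + y) <= eucl_norm x + eucl_norm y.
Proof.
rewrite -(@ler_pXn2r _ 2) ?nnegrE ?addr_ge0 ?eucl_norm_ge0//.
rewrite eucl_norm_sqr sqrrD !eucl_norm_sqr dotpDl !dotpDr (dotpC y).
by have := cauchy_schwarz x y; lra.
Qed.

Lemma eucl_norm_continuous (X : topologicalType) (f : X -> R3) :
  continuous f -> continuous (fun s => eucl_norm (f s)).
Proof. by move=> cf; apply: sqrt_cont; exact: dotp_continuous. Qed.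

End EuclideanNorm.

Lemma homotopic_upair (R : realType) (X Y : topologicalType)
    (a a' b b' : X -> Y) :
  homotopic R a a' -> homotopic R b b' ->
  homotopic R (fun x => upair (a x) (b x)) (fun x => upair (a' x) (b' x)).
Proof.
move=> /homotopicP [H [cH H0 H1]] /homotopicP [G [cG G0 G1]].
apply/homotopicP; exists (fun z => upair (H z) (G z)); split.
- exact: upair_continuous.
- by move=> x; rewrite H0 G0.
- by move=> x; rewrite H1 G1.
Qed.

Lemma homotopic_refl (R : realType) (X Y : topologicalType) (a : X -> Y) :
  continuous a -> homotopic R a a.
Proof.
move=> ca; apply/homotopicP; exists (fun z => a z.1); split => //.
exact: continuousT_comp fst_cont ca.
Qed.

Section ConvexBody.
Context {R : realType} (Omega : set 'rV[R]_3) (o : 'rV[R]_3).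
Local Notation R3 := 'rV[R]_3.
Hypotheses (K_compact : compact Omega) (K_convex : convex_set Omega).
Hypothesis (Ko : Omega° o).
Local Notation rho := (gauge Omega o).
Local Notation bd := (boundary Omega).

Lemma boundaryP x : bd x <-> rho (x - o) = 1.
Proof.
have cK : closed Omega by apply: compact_closed => //; exact: norm_hausdorff.
rewrite /boundary -(proj1 (closure_id _) cK); split=> [[Kx nKx]|x1].
  apply/eqP; rewrite eq_le; apply/andP; split.
    by apply/gaugeP => //; rewrite subrKC.
  rewrite leNgt; apply/negP => x1; apply: nKx.
  by rewrite -(subrKC o x); apply/gauge_interior.
rewrite -(subrKC o x); split; first by apply/gaugeP => //; rewrite x1.
by move/gauge_interior => /(_ K_compact K_convex Ko); rewrite x1 ltxx.
Qed.

Lemma bd_gauge (p : bd) : rho (val p - o) = 1.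
Proof. exact/boundaryP/set_valP. Qed.

Definition radial (y : R3) : R3 := o + (rho y)^-1 *: y.

Lemma gauge_gt0 y : y != 0 -> 0 < rho y.
Proof.
move=> y0; rewrite lt_neqAle eq_sym gauge_ge0// andbT.
by apply: contra_neq y0; exact: gauge_eq0.
Qed.

Lemma radial_bd y : y != 0 -> bd (radial y).
Proof.
move=> y0; apply/boundaryP; rewrite /radial addrC addKr.
rewrite gaugeZ ?invr_ge0 ?gauge_ge0// mulVf// gt_eqF//; exact: gauge_gt0.
Qed.

Lemma radial_id (p : bd) : radial (val p - o) = val p.
Proof. by rewrite /radial bd_gauge invr1 scale1r subrKC. Qed.

Lemma radial_continuous (X : topologicalType) (F : X -> R3) :
  continuous F -> (forall x, F x != 0) -> continuous (fun x => radial (F x)).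
Proof.
move=> cF F0; apply: addv_cont; first exact: cst_cont.
apply: scale_cont => //; apply: inv_cont => [|x].
  2: exact/lt0r_neq0/gauge_gt0.
by apply: (continuousT_comp cF); exact: gauge_continuous.
Qed.

Lemma radial_homotopic (X : topologicalType) (F : X * R -> R3) (f g : X -> bd) :
  continuous F -> (forall x t, 0 <= t <= 1 -> F (x, t) != 0) ->
  (forall x, val (f x) = radial (F (x, 0))) ->
  (forall x, val (g x) = radial (F (x, 1))) -> homotopic R f g.
Proof.
move=> cF F_neq0 F0 F1; pose G (z : X * R) := F (z.1, clamp z.2).
have cG : continuous G.
  apply: (continuousT_comp _ cF); apply: continuous_pair fst_cont _.
  exact: continuousT_comp snd_cont clamp_continuous.
have G_neq0 z : G z != 0 by apply: F_neq0; exact: clamp_itv.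
apply/homotopicP; exists (into (fun z => radial_bd (G_neq0 z))); split.
- exact/into_continuous/radial_continuous.
- by move=> x; apply/val_inj; rewrite /= F0 /G /= clamp_id ?lexx ?ler01.
- by move=> x; apply/val_inj; rewrite /= F1 /G /= clamp_id ?lexx ?ler01.
Qed.

(** The segment starts in the interior, so only its end may touch the
    boundary. *)
Lemma gauge_segment z v a b : rho z < 1 -> 0 <= a < b ->
  rho (z - b *: v) <= 1 -> rho (z - a *: v) < 1.
Proof.
move=> z1 /andP[a0 ab] zb; have b0 : 0 < b by exact: le_lt_trans ab.
have -> : z - a *: v = (1 - a / b) *: z + (a / b) *: (z - b *: v).
  rewrite scalerBr scalerA divfK ?gt_eqF// addrA -scalerDl subrK scale1r//.
have ab0 : 0 <= a / b by rewrite divr_ge0// ltW.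
have ab1 : 0 < 1 - a / b by rewrite subr_gt0 ltr_pdivrMr// mul1r.
rewrite (le_lt_trans (gaugeD K_convex Ko _ _))// !gaugeZ// ?ltW//.
rewrite -[ltRHS](subrK (a / b)); apply: ltr_leD.
  by rewrite gtr_pMr.
by rewrite ler_piMr.
Qed.

(** The time at which the ray from the interior point o + Z x in direction
    - v leaves the body. The gauge is less than 1 before this time and greater
    than 1 after it; these strict inequalities persist near [x], whence the
    continuity. It would fail for rays starting on the boundary, which may run
    along a flat piece of it. *)
Lemma exit_time (X : topologicalType) (Z : X -> R3) (v : R3) :
  continuous Z -> (forall x, rho (Z x) < 1) -> v != 0 ->
  exists2 tau : X -> R, continuous tau &
    forall x, 0 <= tau x /\ rho (Z x - tau x *: v) = 1.
Proof.
move=> cZ Z1 v0.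
have cZv a : continuous (fun x => rho (Z x - a *: v)).
  apply: (@continuousT_comp _ _ _ (fun x => Z x - a *: v)).
    by apply: addv_cont => //; exact: cst_cont.
  exact: gauge_continuous.
have ex x : exists t, 0 <= t /\ rho (Z x - t *: v) = 1.
  have nv0 : 0 < rho (- v) by apply: gauge_gt0; rewrite oppr_eq0.
  pose L := (1 + rho (- Z x)) / rho (- v).
  have L0 : 0 <= L by rewrite divr_ge0 ?addr_ge0 ?gauge_ge0// ltW.
  pose g t := rho (Z x - t *: v).
  have cg : continuous g.
    apply: (@continuousT_comp _ _ _ (fun t : R => Z x - t *: v) rho).
      apply: addv_cont; first exact: cst_cont.
      by apply/oppv_cont/scale_cont; [exact: id_cont|exact: cst_cont].
    exact: gauge_continuous.
  have gL : 1 <= g L.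
    have : rho (L *: - v) <= g L + rho (- Z x).
      rewrite (_ : L *: - v = (Z x - L *: v) - Z x); first exact: gaugeD.
      by rewrite addrAC subrr add0r scalerN.
    by rewrite gaugeZ// divfK ?gt_eqF//; lra.
  have g01 : Num.min (g 0) (g L) <= 1 <= Num.max (g 0) (g L).
    by rewrite ge_min le_max gL orbT andbT /g scale0r subr0 ltW.
  have [t t0L gt] := IVT L0 (continuous_subspaceT cg) g01.
  by exists t; split => //; move: t0L; rewrite in_itv /= => /andP[].
pose tau x := projT1 (cid (ex x)).
have Htau x : 0 <= tau x /\ rho (Z x - tau x *: v) = 1.
  exact: projT2 (cid (ex x)).
exists tau => // x; apply/cvgrPdist_lt => e e0.
have [t0 t1] := Htau x.
have t_gt0 : 0 < tau x.
  rewrite lt_neqAle t0 andbT; apply/eqP => t00.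
  by have := Z1 x; rewrite -[Z x]subr0 -(scale0r v) t00 t1 ltxx.
pose d := Num.min (e / 2) (tau x).
have d0 : 0 < d by rewrite lt_min t_gt0 divr_gt0.
have dt : d <= tau x by rewrite ge_min lexx orbT.
have de : d < e by rewrite gt_min ltr_pdivrMr// ltr_pMr// ltr1n.
have lo : rho (Z x - (tau x - d) *: v) < 1.
  apply: gauge_segment (Z1 x) _ (_ : rho (Z x - tau x *: v) <= 1).
    by rewrite subr_ge0 dt ltrBlDr ltrDl.
  by rewrite t1.
have hi : 1 < rho (Z x - (tau x + d) *: v).
  rewrite ltNge; apply/negP => hi.
  suff : rho (Z x - tau x *: v) < 1 by rewrite t1 ltxx.
  by apply: gauge_segment (Z1 x) _ hi; rewrite t0 ltrDl.
near=> y.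
have [s0 s1] := Htau y.
have lo' : rho (Z y - (tau x - d) *: v) < 1.
  by near: y; apply: (cvgr_lt (rho (Z x - (tau x - d) *: v))) => //; exact: cZv.
have hi' : 1 < rho (Z y - (tau x + d) *: v).
  by near: y; apply: (cvgr_gt (rho (Z x - (tau x + d) *: v))) => //; exact: cZv.
have l1 : tau x - d < tau y.
  rewrite ltNge; apply/negP; rewrite le_eqVlt => /predU1P[E|lt].
    by move: lo'; rewrite -E s1 ltxx.
  suff : rho (Z y - tau y *: v) < 1 by rewrite s1 ltxx.
  by apply: gauge_segment (Z1 y) _ (ltW lo'); rewrite s0.
have l2 : tau y < tau x + d.
  rewrite ltNge; apply/negP; rewrite le_eqVlt => /predU1P[E|lt].
    by move: hi'; rewrite E s1 ltxx.
  have : rho (Z y - (tau x + d) *: v) < 1.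
    apply: gauge_segment (Z1 y) _ (_ : rho (Z y - tau y *: v) <= 1).
      by rewrite addr_ge0// ltW.
    by rewrite s1.
  by move/(lt_trans hi'); rewrite ltxx.
rewrite ltr_distlC (lt_trans _ l1) ?(lt_trans l2)//.
  by rewrite ltrD2l.
by rewrite ltrD2l ltrN2.
Unshelve. all: by end_near. Qed.

(** If a y = b P, comparing gauges gives a <= b, so that [y] is at least as high
    as [P] in direction [v]. *)
Lemma segment_neq0 (v y P : R3) a b : rho y = 1 -> rho P <= 1 ->
  dotp y v < dotp P v -> 0 < dotp P v -> 0 <= a -> 0 <= b -> 0 < a + b ->
  a *: y - b *: P != 0.
Proof.
move=> y1 P1 yP P0 a0 b0 ab0; apply/eqP => /subr0_eq E.
have : rho (a *: y) = rho (b *: P) by rewrite E.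
rewrite !gaugeZ// y1 mulr1 => Ea.
have ab : a <= b by rewrite Ea ler_piMr.
have : dotp (a *: y) v = dotp (b *: P) v by rewrite E.
rewrite !dotpZl => Ev; have b_gt0 : 0 < b by lra.
have : a * dotp P v <= b * dotp P v by rewrite ler_pM2r.
have : 0 < b * dotp P v by rewrite mulr_gt0.
rewrite -Ev; move: a0; rewrite le_eqVlt => /predU1P[<-|a0].
  by rewrite mul0r ltxx.
by move=> _; rewrite ler_pM2l// leNgt yP.
Qed.

(** The point [e x] is shrunk towards [o] by the factor 1 - eps and then
    pushed in direction - v until it leaves the body. The push is at most
    a2 - a1, the thickness of a slab containing the body. Since the exit point
    lies lower than the highest point [p] of the body, it can be contracted
    in the boundary. *)
Lemma convex_body_sweepout (e : sphere R -> bd) (x0 : bd) (v : R3) a1 a2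
    (eps : R) :
  continuous e -> dotp v v = 1 ->
  (forall x, Omega x -> a1 <= dotp x v <= a2) ->
  (exists2 p, Omega p & dotp (val x0) v < dotp p v) ->
  0 < eps < 1 ->
  exists phi phi1 phi2, sweepout e x0 phi phi1 phi2 /\
    forall x, eucl_dist (val (phi1 x)) (val (phi2 x)) <=
      a2 - a1 + eps * eucl_norm (val (e x) - o).
Proof.
move=> ce v1 slab [p' Kp' x0p'] /andP[eps0 eps1].
have cdot : continuous (fun x : R3 => dotp x v).
  by apply: dotp_continuous; [exact: id_cont|exact: cst_cont].
have [p /set_mem Kp pmax] := EVT_max_rV (ex_intro _ p' Kp') K_compact
  (continuous_subspaceT cdot).
have {}pmax x : Omega x -> dotp x v <= dotp p v.
  by move=> Kx; exact/pmax/mem_set.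
have x0p : dotp (val x0 - o) v < dotp (p - o) v.
  by rewrite !dotpBl ltrD2r (lt_le_trans x0p')// pmax.
have v0 : v != 0 by rewrite -dotp_eq0 v1 oner_eq0.
have h0 : 0 < dotp (p - o) v.
  have nv0 := gauge_gt0 v0.
  have Kv : Omega (o + (rho v)^-1 *: v).
    apply/gaugeP => //; rewrite gaugeZ// ?invr_ge0 ?(ltW nv0)//.
    by rewrite mulVf// gt_eqF.
  have := pmax _ Kv; rewrite dotpDl dotpZl v1 mulr1 dotpBl.
  have : 0 < (rho v)^-1 by rewrite invr_gt0.
  by lra.
have p1 : rho (p - o) <= 1 by apply/gaugeP => //; rewrite subrKC.
pose Z x := (1 - eps) *: (val (e x) - o).
have cve : continuous (fun x => val (e x)) by apply/continuous_val.
have cZ : continuous Z.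
  apply: scale_cont; first exact: cst_cont.
  by apply: addv_cont => //; exact: cst_cont.
have Z1 x : rho (Z x) < 1.
  have eps01 : 0 <= 1 - eps by lra.
  by rewrite /Z gaugeZ// bd_gauge mulr1; lra.
have [tau ctau Htau] := exit_time cZ Z1 v0.
pose W x := Z x - tau x *: v.
have W1 x : rho (W x) = 1 by case: (Htau x).
have cW : continuous W.
  apply: addv_cont => //; apply: oppv_cont; apply: scale_cont => //.
  exact: cst_cont.
have Wbd x : bd (o + W x) by apply/boundaryP; rewrite addrC addKr.
pose phi2 : sphere R -> bd := into Wbd.
have cphi2 : continuous phi2.
  by apply/into_continuous/addv_cont => //; exact: cst_cont.
exists (fun x => upair (e x) (phi2 x)), e, phi2; split; last first.
  move=> x; rewrite /eucl_dist /=.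
  have -> : val (e x) - (o + W x) = eps *: (val (e x) - o) + tau x *: v.
    by apply/rowP => j; rewrite /W /Z !mxE; ring.
  rewrite (le_trans (eucl_normD _ _))// !eucl_normZ addrC.
  have [t0 _] := Htau x.
  rewrite (gtr0_norm eps0) (ger0_norm t0) [eucl_norm v]/eucl_norm v1 sqrtr1.
  rewrite mulr1 lerD2r.
  have Kz : Omega (o + Z x) by apply/gaugeP => //; exact: ltW.
  have Kw : Omega (o + W x) by apply/gaugeP => //; rewrite W1.
  have := slab _ Kz; have := slab _ Kw; rewrite !dotpDl dotpNl dotpZl v1.
  by lra.
split => //; first exact: upair_continuous.
apply: homotopic_upair; first exact: homotopic_refl.
(* polygonal path from W x = phi2 x - o to x0 - o through - (p - o);
   it avoids 0 because neither end lies on the ray through p - o *)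
pose F (z : sphere R * R) := Num.max 0 (1 - 2 * z.2) *: W z.1
  - Num.min (2 * z.2) (2 - 2 * z.2) *: (p - o)
  + Num.max 0 (2 * z.2 - 1) *: (val x0 - o).
apply: (@radial_homotopic _ F).
- have c2 : continuous (fun z : sphere R * R => 2 * z.2).
    by apply: mul_cont; [exact: cst_cont|exact: snd_cont].
  have c2' (a : R) : continuous (fun z : sphere R * R => a - 2 * z.2).
    by apply: addv_cont; [exact: cst_cont|exact: oppv_cont].
  apply: addv_cont; first apply: addv_cont.
  + apply: scale_cont; last exact: continuousT_comp fst_cont cW.
    by apply: max_cont => //; exact: cst_cont.
  + by apply/oppv_cont/scale_cont; [exact: min_cont|exact: cst_cont].
  + apply: scale_cont; last exact: cst_cont.
    apply: max_cont; first exact: cst_cont.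
    by apply: addv_cont => //; exact: cst_cont.
- move=> x t /andP[t0 t1]; rewrite /F /=.
  have [t2|t2] := leP t (1 / 2).
    rewrite (max_l (_ : 2 * t - 1 <= 0)); last by lra.
    rewrite (min_l (_ : 2 * t <= 2 - 2 * t)); last by lra.
    rewrite max_r; last by lra.
    rewrite scale0r addr0; apply: (@segment_neq0 v) => //; last 3 first.
    + by lra.
    + by lra.
    + by lra.
    have -> : dotp (W x) v = (1 - eps) * dotp (val (e x) - o) v - tau x.
      by rewrite [LHS]dotpBl /Z !dotpZl v1 mulr1.
    have [t0' _] := Htau x.
    have : dotp (val (e x) - o) v <= dotp (p - o) v.
      rewrite !dotpBl lerD2r; apply: pmax; rewrite -(subrKC o (val _)).
      by apply/gaugeP => //; rewrite bd_gauge.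
    move: (dotp (_ - _) _) (dotp (_ - _) _) h0 => h k k0 hk.
    have := ler_wpM2l (ltW (_ : 0 < 1 - eps)) hk; rewrite subr_gt0 => /(_ eps1).
    have : 0 < eps * k by rewrite mulr_gt0.
    by rewrite mulrBl mul1r; lra.
  rewrite (max_l (_ : 1 - 2 * t <= 0)); last by lra.
  rewrite (min_r (_ : 2 - 2 * t <= 2 * t)); last by lra.
  rewrite max_r; last by lra.
  rewrite scale0r add0r addrC; apply: (@segment_neq0 v) => //.
  + exact: bd_gauge.
  + by lra.
  + by lra.
  + by lra.
- move=> x; rewrite /F /= mulr0 subr0 min_l ?ler0n// max_r ?ler01//.
  rewrite max_l; last by lra.
  by rewrite scale0r subr0 scale0r addr0 scale1r /radial W1 invr1 scale1r.
- move=> x; rewrite /F /= mulr1 subrr min_r ?ler0n// max_l; last by lra.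
  rewrite max_r; last by lra.
  rewrite !scale0r subrr add0r (_ : 2 - 1 = 1); last by lra.
  by rewrite scale1r radial_id.
Qed.

End ConvexBody.

(** * Classical width *)

Section Extrema.
Context {R : realType}.
Implicit Types (A : set R) (m : R).

Lemma minimum_eq A m : A m -> lbound A m -> minimum A = m.
Proof.
move=> Am Lm; rewrite /minimum; case: xgetP => [x _ [Ax Lx]|/(_ m) []//].
by apply/eqP; rewrite eq_le Lx// Lm.
Qed.

Lemma maximum_eq A m : A m -> ubound A m -> maximum A = m.
Proof.
move=> Am Um; rewrite /maximum; case: xgetP => [x _ [Ax Ux]|/(_ m) []//].
by apply/eqP; rewrite eq_le Ux// Um.
Qed.

Lemma inf_eq A m : A m -> lbound A m -> inf A = m.
Proof.
move=> Am Lm; apply/eqP; rewrite eq_le ge_inf//=; last by exists m.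
by apply: lb_le_inf => //; exists m.
Qed.

End Extrema.

Section Width.
Context {R : realType} (Omega : set 'rV[R]_3).
Local Notation R3 := 'rV[R]_3.
Hypotheses (K_compact : compact Omega) (K_neq0 : Omega !=set0).

Lemma plane_dist (v : R3) a b : dotp v v = 1 -> a <= b ->
  eucl_set_dist (plane v a) (plane v b) = b - a.
Proof.
move=> v1 ab; have nv1 : eucl_norm v = 1 by apply/sphereE.
apply: inf_eq.
  exists (a *: v, b *: v).
    by split; rewrite /plane /= dotpZl v1 mulr1.
  rewrite /eucl_dist /= -scalerBl eucl_normZ nv1 mulr1 distrC.
  by rewrite ger0_norm ?subr_ge0.
move=> _ [[p q] [/= pa qb] <-]; rewrite /eucl_dist -[p - q]opprB.
rewrite /eucl_norm dotpNl dotpNr opprK -/(eucl_norm (q - p)).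
have := cauchy_schwarz (q - p) v.
by rewrite nv1 mulr1 dotpBl -[dotp q v]/(dotp q v) pa qb.
Qed.

(** The optimal slab is bounded by the two supporting planes. *)
Lemma dir_widthP (v : R3) : dotp v v = 1 -> exists xm xM,
  [/\ Omega xm, Omega xM,
      forall x, Omega x -> dotp xm v <= dotp x v <= dotp xM v
    & dir_width Omega v = dotp xM v - dotp xm v].
Proof.
move=> v1.
have cdot : continuous (fun x : R3 => dotp x v).
  by apply: dotp_continuous; [exact: id_cont|exact: cst_cont].
have [M /set_mem KM Mmax] := EVT_max_rV K_neq0 K_compact
  (continuous_subspaceT cdot).
have [m /set_mem Km mmin] := EVT_min_rV K_neq0 K_compact
  (continuous_subspaceT cdot).
have H x : Omega x -> dotp m v <= dotp x v <= dotp M v.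
  by move=> /mem_set Kx; rewrite mmin// Mmax.
have mM : dotp m v <= dotp M v by have /andP[] := H _ KM.
exists m, M; split => //; apply: minimum_eq.
  by exists (dotp m v, dotp M v) => //=; rewrite plane_dist.
move=> _ [[a b] [/= ab Hab] <-]; rewrite plane_dist//.
have /andP[am _] := Hab _ Km; have /andP[_ Mb] := Hab _ KM.
by rewrite lerB.
Qed.

Lemma dir_width_ge (v x y : R3) : dotp v v = 1 -> Omega x -> Omega y ->
  dotp (x - y) v <= dir_width Omega v.
Proof.
move=> v1 Kx Ky; have [m [M [_ _ H ->]]] := dir_widthP v1.
rewrite dotpBl; have /andP[_ xM] := H _ Kx; have /andP[my _] := H _ Ky.
by rewrite lerB.
Qed.

(** The minimum is attained because [dir_width] is Lipschitz on the
    sphere. *)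
Lemma widthP : exists2 v : R3, dotp v v = 1 & width Omega = dir_width Omega v /\
  forall u, dotp u u = 1 -> width Omega <= dir_width Omega u.
Proof.
pose N (x : R3) := eucl_norm x.
have cN : continuous N by apply: eucl_norm_continuous; exact: id_cont.
have [x1 _ HB] := EVT_max_rV K_neq0 K_compact (continuous_subspaceT cN).
pose B := N x1 + N x1 + 1.
have B0 : 0 < B by rewrite ltr_wpDl// addr_ge0// eucl_norm_ge0.
have lip (u v : R3) : dotp u u = 1 -> dotp v v = 1 ->
    dir_width Omega u <= dir_width Omega v + B * N (u - v).
  move=> u1 v1; have [m [M [Km KM _ ->]]] := dir_widthP u1.
  rewrite -dotpBl -(subrKC v u) dotpDr lerD ?dir_width_ge//.
  rewrite (le_trans (cauchy_schwarz _ _))// subrKC.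
  rewrite ler_wpM2r ?eucl_norm_ge0// (le_trans (eucl_normD _ _))//.
  rewrite -[- m]scaleN1r eucl_normZ normrN1 mul1r -[leLHS]addr0.
  by rewrite lerD// lerD// HB// inE.
have cw : continuous (fun v : sphere R => dir_width Omega (val v)).
  apply: (@continuous_dominated _ _ _
    (fun v u : sphere R => B * N (val v - val u))) => [v|v|v u].
  - apply: mul_cont; first exact: cst_cont.
    apply: eucl_norm_continuous; apply: addv_cont; first exact: cst_cont.
    by apply: oppv_cont; exact: val_continuous.
  - by rewrite subrr /N (eqP (_ : eucl_norm 0 == 0)) ?eucl_norm_eq0// mulr0.
  - have NC : N (val u - val v) = N (val v - val u).
      by rewrite -opprB /N -scaleN1r eucl_normZ normrN1 mul1r.
    by rewrite ler_distl lerBlDr -{1}NC !lip//; exact: sphere_dotp.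
have S0 : [set: sphere R] !=set0.
  have e1 : sphere R (row3 1 0 0) by apply/sphereE; rewrite dotpE !row3E; ring.
  by exists (exist _ (row3 1 0 0) (mem_set e1)).
have [v _ vmin] := compact_EVT_min S0 sphere_compactT (continuous_subspaceT cw).
have W : width Omega = dir_width Omega (val v).
  apply: minimum_eq; first by exists (val v) => //; exact: set_valP.
  by move=> _ [u Su <-]; apply: (vmin (exist _ u (mem_set Su))); rewrite inE.
exists (val v); first exact: sphere_dotp.
split => // u /sphereE Su; rewrite W.
by apply: (vmin (exist _ u (mem_set Su))); rewrite inE.
Qed.

End Width.

(** * Far pairs in every sweepout *)

Lemma compact_seq_cover (X : topologicalType) (I : eqType) (U : I -> set X) :
  compact [set: X] -> (forall x : X, exists i, nbhs x (U i)) ->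
  exists s : seq I, forall x : X, exists2 i, i \in s & U i x.
Proof.
move=> /compact_near_coveringP cX ex.
pose F : set_system (seq I) :=
  filter_from setT (fun s0 : seq I => [set s : seq I | {subset s0 <= s}]).
have FF : Filter F.
  apply: filter_from_filter; first by exists [::].
  move=> s t _ _; exists (s ++ t) => // r st; split=> i Hi; apply: st.
    by rewrite mem_cat Hi.
  by rewrite mem_cat Hi orbT.
pose P (s : seq I) x := exists2 i, i \in s & U i x.
have [x _|s _ Hs] := cX _ F P FF.
  have [i Ui] := ex x.
  exists (U i, [set s : seq I | {subset [:: i] <= s}]) => /=.
    by split => //; exists [:: i].
  by move=> [y s] /= [Uy si]; exists i => //; apply: si; rewrite mem_head.
by exists s => x; apply: (Hs s).
Qed.

Section SmoothBoundary.
Context {R : realType}.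
Local Notation R3 := 'rV[R]_3.

Lemma smooth_continuous (A B : set R3) (f : A -> B) : smooth f -> continuous f.
Proof.
move=> sf; apply/continuous_val => a.
have [U [F [oU Ua CF fF]]] := sf a.
have /= [cF _] := CF 0%N.
have cFa : (fun x : A => F (val x)) x @[x --> a] --> F (val a).
  by apply: continuous_comp; [exact: val_continuous|exact: cF].
have nU : nbhs a [set x : A | U (val x)].
  by apply: (@val_continuous _ A a); exact: open_nbhs_nbhs.
rewrite /continuous_at fF// => D /cFa FD.
have UF (x : A) : U (val x) -> D (F (val x)) -> D (val (f x)).
  by move=> Ux; rewrite fF.
exact: (@filterS2 A (nbhs a) _ _ [set x : A | D (F (val x))]
  [set x : A | D (val (f x))] UF nU FD).
Qed.

(** A chart at a boundary point maps onto an open set, which contains points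
    with positive last coordinate; these correspond to interior points. *)
Lemma smooth_boundary_interior (A : set R3) p :
  closed A -> smooth_boundary A -> boundary A p -> A° !=set0.
Proof.
move=> cA sA bp; have Ap : A p.
  by case: bp; rewrite -(proj1 (closure_id _) cA).
have [U [V [f [oU oV Up [sf [g [fK gK _]]] Hf]]]] := sA _ bp.
have cf := smooth_continuous sf.
pose p' : U := exist _ p (mem_set Up).
have fp0 : 0 <= val (f p') 0 ord_max by apply/Hf.
have /nbhs_ballP [r /= r0 Vr] : nbhs (val (f p')) V.
  by apply: open_nbhs_nbhs; split => //; exact: set_valP.
pose q := val (f p') + (r / 2) *: delta_mx 0 ord_max.
have r2 : 0 < r / 2 by rewrite divr_gt0.
have Vq : V q.
  apply: Vr; rewrite -ball_normE /= /q opprD addNKr normrN normrZ gtr0_norm//.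
  rewrite (@le_lt_trans _ _ (r / 2))//; last first.
    by rewrite ltr_pdivrMr// ltr_pMr// ltr1n.
  rewrite ler_piMr ?(ltW r2)// -[leLHS]/(mx_norm _) mx_normrE.
  apply/bigmax_leP; split => // -[i j] _ /=.
  by rewrite mxE; case: (_ && _); rewrite ?normr1 ?normr0.
have q0 : 0 < q 0 ord_max.
  by rewrite !mxE !eqxx /= mulr1 ltr_wpDl.
pose x : U := g (exist _ q (mem_set Vq)).
have fx : val (f x) = q by rewrite gK.
exists (val x); rewrite /interior /=.
have : \forall y \near x, 0 < val (f y) 0 ord_max.
  have /row_continuousP/(_ ord_max) cvf : continuous (fun y : U => val (f y)).
    exact/continuous_val.
  by apply: (cvgr_gt _ (cvf x)); rewrite fx.
move=> [_ /= [[W oW <-] Wx] WH].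
have UWx : nbhs (val x) (U `&` W).
  by apply: open_nbhs_nbhs; split; [exact: openI|split => //; exact: set_valP].
apply: filterS UWx => y [Uy Wy].
have /= := WH (exist _ y (mem_set Uy)) Wy.
by move/ltW; exact: (Hf (exist _ y (mem_set Uy))).2.
Qed.

End SmoothBoundary.

Section LowerBound.
Context {R : realType} (Omega : set 'rV[R]_3) (o : 'rV[R]_3).
Local Notation R3 := 'rV[R]_3.
Hypotheses (K_compact : compact Omega) (K_convex : convex_set Omega).
Hypothesis (Ko : Omega° o).
Local Notation rho := (gauge Omega o).
Local Notation bd := (boundary Omega).

Let K_neq0 : Omega !=set0. Proof. by exists o; exact: interior_subset Ko. Qed.

(** The vectors a - b form a compact convex set. If it misses [u], let [n] be
    the vector from its nearest point to [u]: the width of the body in the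
    direction of [n] is less than |u|. *)
Lemma difference_body (u : R3) : eucl_norm u < width Omega ->
  exists a b, [/\ Omega a, Omega b & a - b = u].
Proof.
move=> uw.
have cKK : compact (Omega `*` Omega) by exact: compact_setX.
have cD : continuous (fun z : R3 * R3 =>
    dotp (u - (z.1 - z.2)) (u - (z.1 - z.2))).
  have c : continuous (fun z : R3 * R3 => u - (z.1 - z.2)).
    apply: addv_cont; first exact: cst_cont.
    apply: oppv_cont; apply: addv_cont; first exact: fst_cont.
    by apply: oppv_cont; exact: snd_cont.
  exact: dotp_continuous.
have KK0 : Omega `*` Omega !=set0 by case: K_neq0 => x Kx; exists (x, x).
have [[a b] /set_mem [/= Ka Kb] ab_min] :=
  compact_EVT_min KK0 cKK (continuous_subspaceT cD).
exists a, b; split => //; apply/eqP; apply: contraTT uw => nab.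
pose n := u - (a - b).
have n0 : n != 0 by rewrite subr_eq0 eq_sym.
have nn0 : 0 < eucl_norm n.
  by rewrite lt_neqAle eq_sym eucl_norm_eq0 n0 eucl_norm_ge0.
(* first-order condition at the nearest point a - b: along the segment
   towards c - d the time [s] is chosen so small that the quadratic term does
   not compensate the linear one *)
have var c d : Omega c -> Omega d -> dotp (c - d) n <= dotp (a - b) n.
  move=> Kc Kd; rewrite -subr_le0 -dotpBl; set k := _ - _ - _.
  rewrite leNgt; apply/negP => k0.
  have kk0 : 0 < dotp k k.
    rewrite lt_neqAle eq_sym dotp_eq0 dotp_ge0 andbT.
    by apply: contraTneq k0 => ->; rewrite -(scale0r n) dotpZl mul0r ltxx.
  pose s := Num.min 1 (dotp k n / dotp k k).
  have s0 : 0 < s by rewrite lt_min ltr01 divr_gt0.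
  have s01 : 0 <= s <= 1 by rewrite ltW//= ge_min lexx.
  have skk : s * dotp k k <= dotp k n.
    by rewrite -ler_pdivlMr// ge_min lexx orbT.
  have := ab_min (s *: c + (1 - s) *: a, s *: d + (1 - s) *: b).
  rewrite inE => /(_ _)/wrap[|/=].
    by split => /=; exact: convex_set_comb.
  rewrite -/n (_ : u - _ = n - s *: k); last first.
    by apply/rowP => j; rewrite /n /k !mxE; ring.
  rewrite dotp_subZ.
  have : 0 < s * dotp k n by rewrite mulr_gt0.
  have : s * (s * dotp k k) <= s * dotp k n by rewrite ler_pM2l.
  by lra.
rewrite -leNgt.
pose v := (eucl_norm n)^-1 *: n.
have v1 : dotp v v = 1.
  by rewrite dotpZl dotpZr -eucl_norm_sqr expr2 mulKf ?mulVf ?gt_eqF.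
have [_ _ [_ wle]] := widthP K_compact K_neq0.
rewrite (le_trans (wle v v1))//.
have [m [M [Km KM _ ->]]] := dir_widthP K_compact K_neq0 v1.
rewrite -dotpBl dotpZr (le_trans (ler_wpM2l _ (var _ _ KM Km)))//.
  by rewrite invr_ge0 ltW.
have -> : a - b = u - n by rewrite /n opprB subrKC.
rewrite dotpBl -eucl_norm_sqr ler_pdivrMl// mulrC.
by have := cauchy_schwarz u n; have := sqr_ge0 (eucl_norm n); lra.
Qed.

(** A translate of the body by a vector shorter than its width meets the body
    in an interior point: a slightly longer multiple [l *: u] is a difference of
    two points of the body, and shrinking these towards [o] by the factor [l]
    makes them interior with difference [u]. *)
Lemma common_interior (u : R3) : eucl_norm u < width Omega ->
  exists y, rho (y - o) < 1 /\ rho (y - u - o) < 1.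
Proof.
move=> uw; have [->|u0] := eqVneq u 0.
  by exists o; rewrite subr0 subrr gauge0// ltr01.
have nu0 : 0 < eucl_norm u.
  by rewrite lt_neqAle eq_sym eucl_norm_eq0 u0 eucl_norm_ge0.
pose l := (eucl_norm u + width Omega) / (2 * eucl_norm u).
have l1 : 1 < l by rewrite ltr_pdivlMr ?mulr_gt0// mul1r; lra.
have l0 : 0 < l by rewrite (lt_trans _ l1).
have lu : eucl_norm (l *: u) < width Omega.
  rewrite eucl_normZ gtr0_norm// /l invfM mulrA divfK ?gt_eqF//.
  by rewrite ltr_pdivrMr//; lra.
have [a [b [Ka Kb ab]]] := difference_body lu.
have H c : Omega c -> rho (l^-1 *: (c - o)) < 1.
  move=> Kc; rewrite gaugeZ ?invr_ge0 ?(ltW l0)// ltr_pdivrMl// mulr1.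
  by rewrite (le_lt_trans _ l1)//; apply/gaugeP => //; rewrite subrKC.
exists (o + l^-1 *: (a - o)); split; first by rewrite addrC addKr H.
rewrite (_ : _ - _ - o = l^-1 *: (b - o)); first exact: H.
have -> : u = l^-1 *: (a - b) by rewrite ab scalerA mulVf ?gt_eqF// scale1r.
by apply/rowP => j; rewrite !mxE; ring.
Qed.

(** Each [b i - p] points from the boundary point [p] into the interior, hence
    so does their positive combination, d say. The segment from p - o to - d
    would meet 0 only if p - o were a nonnegative multiple of d; but the radial
    direction p - o points outwards at [p]. *)
Lemma inward_sum_neq0 (I : Type) (r : seq I) (c : I -> R) (b : I -> R3) (p : R3)
    (t : R) :
  rho (p - o) = 1 -> (forall i, 0 <= c i) ->
  (forall i, 0 < c i -> rho (b i - o) < 1) -> 0 < \sum_(i <- r) c i ->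
  0 <= t <= 1 ->
  (1 - t) *: (p - o) + t *: - (\sum_(i <- r) c i *: (b i - p)) != 0.
Proof.
move=> p1 c0 b1; set C := \sum_(i <- r) c i => C0 /andP[t0 t1].
pose B := \sum_(i <- r) c i *: (b i - o).
have BC : rho B < C.
  suff : rho B <= C /\ (0 < C -> rho B < C) by case=> _; exact.
  rewrite /B /C; elim: r {C C0 B} => [|i r [IH1 IH2]].
    by rewrite !big_nil gauge0// ltxx.
  rewrite !big_cons.
  have cb : rho (c i *: (b i - o)) <= c i.
    rewrite gaugeZ//; have := c0 i; rewrite le_eqVlt => /predU1P[<-|ci].
      by rewrite mul0r.
    by rewrite ler_piMr// ltW// b1.
  have cb' : 0 < c i -> rho (c i *: (b i - o)) < c i.
    by move=> ci; rewrite gaugeZ// gtr_pMr// b1.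
  have S := gaugeD K_convex Ko (c i *: (b i - o))
    (\sum_(j <- r) c j *: (b j - o)).
  split; first by rewrite (le_trans S)// lerD.
  move=> s0; rewrite (le_lt_trans S)//.
  have := c0 i; rewrite le_eqVlt => /predU1P[ci|ci].
    by rewrite ler_ltD// IH2//; move: s0; rewrite -ci add0r.
  by rewrite ltr_leD// cb'.
have -> : \sum_(i <- r) c i *: (b i - p) = B - C *: (p - o).
  rewrite /B /C scaler_suml -sumrB; apply: eq_bigr => i _.
  by rewrite -scalerBr opprB addrA subrK.
clearbody B C; apply/eqP => /rowP E0.
have E : (1 - t + t * C) *: (p - o) = t *: B.
  by apply/rowP => j; have := E0 j; rewrite !mxE; lra.
have : rho ((1 - t + t * C) *: (p - o)) = rho (t *: B) by rewrite E.
have tC : 0 <= t * C by rewrite mulr_ge0// ltW.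
rewrite !gaugeZ// ?p1 ?mulr1; last by lra.
have := t0; rewrite le_eqVlt => /predU1P[<-|t_gt0]; first by rewrite !mul0r; lra.
have : t * rho B < t * C by rewrite ltr_pM2l.
by lra.
Qed.

(** By [common_interior], at each [x] some vector points into the body both at
    [phi1 x] and at [phi2 x]: with y and y - u x interior, it is
    y - phi1 x = (y - u x) - phi2 x. Such vectors form a convex set, and
    finitely many points y suffice, so weights [theta] assemble them into a
    continuous field [d]. Seen from [o], neither [phi1 x] nor [phi2 x] is
    opposite to [- d x], and both maps are moved to the radial projection of
    [- d] along straight segments. *)
Lemma close_pairs_homotopic (phi1 phi2 : sphere R -> bd) :
  continuous phi1 -> continuous phi2 ->
  (forall x, eucl_dist (val (phi1 x)) (val (phi2 x)) < width Omega) ->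
  exists2 f : sphere R -> bd, continuous f &
    homotopic R phi1 f /\ homotopic R phi2 f.
Proof.
move=> c1 c2 close.
have cv1 : continuous (fun x => val (phi1 x)) by apply/continuous_val.
have cv2 : continuous (fun x => val (phi2 x)) by apply/continuous_val.
pose u x := val (phi1 x) - val (phi2 x).
have cu : continuous u by apply: addv_cont => //; exact: oppv_cont.
pose theta (y : R3) x := Num.max 0 (1 - Num.max (rho (y - o)) (rho (y - u x - o))).
have ctheta y : continuous (theta y).
  apply: max_cont; first exact: cst_cont.
  apply: addv_cont; first exact: cst_cont.
  apply: oppv_cont; apply: max_cont; first exact: cst_cont.
  apply: (@continuousT_comp _ _ _ (fun x => y - u x - o) rho).
    apply: addv_cont; last exact: cst_cont.
    by apply: addv_cont; [exact: cst_cont|exact: oppv_cont].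
  exact: gauge_continuous.
have theta_ge0 y x : 0 <= theta y x by rewrite /theta le_max lexx.
have thetaP y x : 0 < theta y x -> rho (y - o) < 1 /\ rho (y - u x - o) < 1.
  by rewrite /theta lt_max ltxx /= subr_gt0 gt_max => /andP.
have [x|D Dcov] := compact_seq_cover sphere_compactT
    (_ : forall x : sphere R, exists y, nbhs x [set x | 0 < theta y x]).
  have [y [y1 y2]] := common_interior (close x).
  exists y; apply: (cvgr_gt _ (ctheta y x)).
  by rewrite /theta lt_max ltxx /= subr_gt0 gt_max y1 y2.
pose d x := \sum_(y <- D) theta y x *: (y - val (phi1 x)).
have cd : continuous d.
  apply: sum_continuous => y _; apply: scale_cont => //.
  by apply: addv_cont; [exact: cst_cont|exact: oppv_cont].
have S0 x : 0 < \sum_(y <- D) theta y x.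
  have [y Dy thy] := Dcov x.
  by rewrite (big_rem y)//= ltr_pwDl//; apply: sumr_ge0.
have d1 x t : 0 <= t <= 1 -> (1 - t) *: (val (phi1 x) - o) + t *: - d x != 0.
  apply: inward_sum_neq0 => //; first exact: bd_gauge.
  by move=> y /thetaP[].
have d2 x t : 0 <= t <= 1 -> (1 - t) *: (val (phi2 x) - o) + t *: - d x != 0.
  rewrite (_ : d x = \sum_(y <- D)
    theta y x *: ((y - u x) - val (phi2 x))).
    apply: (@inward_sum_neq0 _ _ _ (fun y => y - u x)) => //.
      exact: bd_gauge.
    by move=> y /thetaP[].
  apply: eq_bigr => y _; congr (_ *: _).
  by apply/rowP => j; rewrite /u !mxE; ring.
have nd0 x : - d x != 0.
  by have := d1 x 1; rewrite subrr scale0r add0r scale1r; apply; rewrite ler01 lexx.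
pose f : sphere R -> bd := into (fun x => radial_bd K_compact K_convex Ko (nd0 x)).
have cf : continuous f.
  by apply/into_continuous/radial_continuous => //; exact: oppv_cont.
have hom (phi : sphere R -> bd) : continuous phi ->
    (forall x t, 0 <= t <= 1 -> (1 - t) *: (val (phi x) - o) + t *: - d x != 0) ->
    homotopic R phi f.
  move=> cphi phid; have cvphi : continuous (fun x => val (phi x)).
    exact/continuous_val.
  apply: (@radial_homotopic _ _ o _ _ _ _
    (fun z => (1 - z.2) *: (val (phi z.1) - o) + z.2 *: - d z.1)) => //.
  - have c1t : continuous (fun z : sphere R * R => 1 - z.2).
      by apply: addv_cont; [exact: cst_cont|apply: oppv_cont; exact: snd_cont].
    apply: addv_cont; apply: scale_cont => //; last 2 first.
    + exact: snd_cont.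
    + by apply: oppv_cont; exact: continuousT_comp fst_cont cd.
    + apply: addv_cont; last exact: cst_cont.
      exact: (continuousT_comp fst_cont cvphi).
  - by move=> x /=; rewrite subr0 scale1r scale0r addr0 radial_id.
  - by move=> x /=; rewrite subrr scale0r add0r scale1r.
by exists f => //; split; exact: hom.
Qed.

Lemma sweepout_far_pair (e : sphere R -> bd) (x0 : bd) phi phi1 phi2 :
  sphere_embedding e -> sweepout e x0 phi phi1 phi2 ->
  exists x, width Omega <= eucl_dist (val (phi1 x)) (val (phi2 x)).
Proof.
move=> [se [g [eK gK sg]]] [_ hom c1 c2 phiE].
apply: contrapT => /forallNP far.
have [x|f cf [hom1 hom2]] := close_pairs_homotopic c1 c2.
  by rewrite ltNge; apply/negP/far.
apply: (upair_cst_not_diag (smooth_continuous sg) eK cf hom).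
rewrite (_ : phi = fun x => upair (phi1 x) (phi2 x)); last exact/funext.
exact: homotopic_upair.
Qed.

End LowerBound.

(** * Equality of the widths *)

Lemma sphere_max (R : realType) (h : sphere R -> R) : continuous h ->
  exists2 c, (forall x, h x <= h c) & maximum (range h) = h c.
Proof.
move=> ch.
have e1 : sphere R (row3 1 0 0) by apply/sphereE; rewrite dotpE !row3E; ring.
have S0 : [set: sphere R] !=set0 by exists (exist _ (row3 1 0 0) (mem_set e1)).
have [c _ cmax] := compact_EVT_max S0 sphere_compactT (continuous_subspaceT ch).
have {}cmax x : h x <= h c by apply: cmax; rewrite inE.
by exists c => //; apply: maximum_eq; [exists c|move=> _ [x _ <-]].
Qed.

Lemma pair_dist_continuous (R : realType) (X : topologicalType)
    (S : set 'rV[R]_3) (f g : X -> S) :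
  continuous f -> continuous g ->
  continuous (fun x => eucl_dist (val (f x)) (val (g x))).
Proof.
move=> /continuous_val cf /continuous_val cg.
by apply: eucl_norm_continuous; apply: addv_cont => //; exact: oppv_cont.
Qed.

Theorem proposition1p14 (R : realType) (Omega : set 'rV[R]_3)
    (Omega_compact : compact Omega)
    (Omega_convex : convex_set Omega)
    (Omega_regular : regular_domain Omega)
    (e : sphere R -> boundary Omega) (e_embedding : sphere_embedding e)
    (x0 : boundary Omega) :
  minmax_width e x0 = width Omega.
Proof.
have [neq0 _ smoothO] := Omega_regular.
have [z Kz] : Omega° !=set0.
  apply: (smooth_boundary_interior _ smoothO (set_valP x0)).
  by apply: compact_closed => //; exact: norm_hausdorff.
have ce : continuous e by apply: smooth_continuous; case: e_embedding.
have far phi phi1 phi2 : sweepout e x0 phi phi1 phi2 ->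
    width Omega <=
    maximum (range (fun x => eucl_dist (val (phi1 x)) (val (phi2 x)))).
  move=> sw; have [_ _ c1 c2 _] := sw.
  have [x wx] := sweepout_far_pair Omega_compact Omega_convex Kz e_embedding sw.
  have [c hc ->] := sphere_max (pair_dist_continuous c1 c2).
  exact: le_trans wx (hc x).
have short_pairs eps : 0 < eps ->
    exists phi phi1 phi2, sweepout e x0 phi phi1 phi2 /\
    maximum (range (fun x => eucl_dist (val (phi1 x)) (val (phi2 x)))) <=
    width Omega + eps.
  move=> eps0.
  have [v v1 [wv _]] := widthP Omega_compact neq0.
  have [m [M [Km KM slab dwv]]] := dir_widthP Omega_compact neq0 v1.
  have cn : continuous (fun x => eucl_norm (val (e x) - z)).
    apply: eucl_norm_continuous; apply: addv_cont; last exact: cst_cont.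
    exact/continuous_val.
  have [c cmax _] := sphere_max cn.
  set C := eucl_norm (val (e c) - z) in cmax.
  have C0 : 0 <= C by exact: eucl_norm_ge0.
  (* a shrinking factor between 0 and 1 with d * C <= eps *)
  pose d := eps / (eps + C + 1).
  have dC : d * C <= eps by rewrite /d mulrAC ler_pdivrMr; nra.
  have d01 : 0 < d < 1 by rewrite /d divr_gt0/= ?ltr_pdivrMr; lra.
  have mM : dotp m v < dotp M v.
    have v0 : v != 0 by rewrite -dotp_eq0 v1 oner_eq0.
    have rv := gauge_gt0 Omega_compact Omega_convex Kz v0.
    have Kv : Omega (z + (gauge Omega z v)^-1 *: v).
      apply/gaugeP => //; rewrite gaugeZ// ?invr_ge0 ?(ltW rv)//.
      by rewrite mulVf// gt_eqF.
    have /andP[+ _] := slab z (interior_subset Kz).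
    have /andP[_ +] := slab _ Kv; rewrite dotpDl dotpZl v1 mulr1.
    have : 0 < (gauge Omega z v)^-1 by rewrite invr_gt0.
    by lra.
  (* x0 cannot be a highest point for both [v] and [- v] *)
  have [u [a1 [a2 [u1 aw uslab up]]]] : exists u a1 a2, [/\ dotp u u = 1,
      a2 - a1 = width Omega, forall x, Omega x -> a1 <= dotp x u <= a2 &
      exists2 p, Omega p & dotp (val x0) u < dotp p u].
    have [x0M|x0M] := ltP (dotp (val x0) v) (dotp M v).
      by exists v, (dotp m v), (dotp M v); split; rewrite ?wv//; exists M.
    exists (- v), (- dotp M v), (- dotp m v); split.
    - by rewrite dotpNl dotpNr opprK.
    - by rewrite wv dwv opprK addrC.
    - by move=> x /slab /andP[xm xM]; rewrite dotpNr !lerN2 xm xM.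
    - by exists m => //; rewrite !dotpNr ltrN2 (lt_le_trans mM).
  have [phi [phi1 [phi2 [sw close]]]] :=
    convex_body_sweepout Omega_compact Omega_convex Kz ce u1 uslab up d01.
  exists phi, phi1, phi2; split => //; have [_ _ c1 c2 _] := sw.
  have [c' _ ->] := sphere_max (pair_dist_continuous c1 c2).
  rewrite (le_trans (close c'))// aw lerD2l (le_trans _ dC)//.
  by rewrite ler_wpM2l//; case/andP: d01 => /ltW.
apply/eqP; rewrite eq_le; apply/andP; split.
  apply/ler_addgt0Pr => eps eps0.
  have [phi [phi1 [phi2 [sw le_w]]]] := short_pairs _ eps0.
  apply: le_trans le_w; apply: ge_inf; last by exists phi, phi1, phi2.
  by exists (width Omega) => _ [? [? [? [/far ? ->]]]].
apply: lb_le_inf => [|_ [? [? [? [/far ? ->]]]]//].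
have [phi [phi1 [phi2 [sw _]]]] := short_pairs 1 ltr01.
by eexists; exists phi, phi1, phi2; split.
Qed.
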